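(* Let $\Bbbk$ be an algebraically closed field of characteristic $p>2$ and let $\widetilde D$ be the algebra defined in the context. Then: (i) The algebra $\widetilde D$ admits an exhaustive ascending filtration $(\widetilde D_n)_{n\in\mathbb N_0}$ such that $\operatorname{gr}\widetilde D\simeq\Bbbk[T^{\pm1}]\otimes\Bbbk[X_1,\dots,X_5]$. (ii) $\widetilde D$ is a noetherian domain. (iii) $\widetilde D$ is a PI-algebra (i.e. it satisfies a polynomial identity).
   Context: $\widetilde D$ (the double of the Jordan plane) is the algebra presented by generators $u,v,\zeta,\mathbf g^{\pm1},x,y$ and relations \begin{align*} & \mathbf g^{\pm1}\mathbf g^{\mp1}=1,\ \mathbf gx=x\mathbf g,\ \mathbf gy=y\mathbf g+x\mathbf g,\ yx=xy-\tfrac12x^2,\ v\zeta=\zeta v+v,\ u\zeta=\zeta u+u,\ vu=uv-\tfrac12u^2,\\ & \zeta y=y\zeta+y,\ \zeta x=x\zeta+x,\ v\mathbf g=\mathbf gv+\mathbf gu,\ u\mathbf g=\mathbf gu,\ vx=xv+(1-\mathbf g)+xu,\ ux=xu,\\ & uy=yu+(1-\mathbf g),\ vy=yv-\mathbf g\zeta+yu,\ \zeta\mathbf g=\mathbf g\zeta. \end{align*} It has basis $\{x^ny^r\mathbf g^m\zeta^ku^iv^j: i,j,k,n,r\in\mathbb N_0,\ m\in\mathbb Z\}$. *)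

(* Defs.v *)
From HB Require Import structures.
From mathcomp Require Import all_boot all_order all_algebra.
From mathcomp Require Import finmap boolp monalg.

Set Implicit Arguments.
Unset Strict Implicit.
Unset Printing Implicit Defensive.

Import GRing.Theory.
Local Open Scope ring_scope.

(* Two-sided ideals and quotient algebras.  MathComp's {ideal_quot _} only
   covers commutative rings.  Ideals are required to be proper because an
   algType is nontrivial by definition. *)
Record proper_ideal2 (k : comNzRingType) (A : algType k) (I : A -> Prop) : Prop
  := ProperIdeal2 {
  pi2_0 : I 0;
  pi2_D : forall a b, I a -> I b -> I (a + b);
  pi2_Ml : forall a b, I b -> I (a * b);
  pi2_Mr : forall a b, I a -> I (a * b);
  pi2_1 : ~ I 1 }.

Section QuotientAlgebra.
Variables (k : comNzRingType) (A : algType k) (I : A -> Prop).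
Hypothesis hI : proper_ideal2 I.

Definition ideal_rel (a b : A) : bool := `[< I (a - b) >].

Let IN a : I a -> I (- a).
Proof. by move=> Ia; rewrite -mulN1r; apply: (pi2_Ml hI). Qed.

Fact ideal_rel_refl : reflexive ideal_rel.
Proof. by move=> a; apply/asboolP; rewrite subrr; apply: (pi2_0 hI). Qed.

Fact ideal_rel_sym : symmetric ideal_rel.
Proof.
by move=> a b; apply/asboolP/asboolP => /IN; rewrite opprB.
Qed.

Fact ideal_rel_trans : transitive ideal_rel.
Proof.
move=> b a c /asboolP Iab /asboolP Ibc; apply/asboolP.
by rewrite -(subrK b a) -addrA; apply: (pi2_D hI).
Qed.

Definition ideal_equiv := EquivRel ideal_rel
  ideal_rel_refl ideal_rel_sym ideal_rel_trans.

Definition quot_alg := {eq_quot ideal_equiv}%qT.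
HB.instance Definition _ : EqQuotient A ideal_equiv quot_alg :=
  EqQuotient.on quot_alg.
HB.instance Definition _ := Choice.on quot_alg.

Definition quot_pi (a : A) : quot_alg := (\pi_quot_alg a)%qT.

Lemma quot_piP a b : quot_pi a = quot_pi b <-> I (a - b).
Proof.
split=> [/(@eqquotP _ _ quot_alg)/asboolP //|Iab].
by apply/(@eqquotP _ _ quot_alg)/asboolP.
Qed.

Lemma quot_reprK (x : quot_alg) : quot_pi (repr x) = x.
Proof. exact: reprK. Qed.

Let qadd (x y : quot_alg) := quot_pi (repr x + repr y).
Let qopp (x : quot_alg) := quot_pi (- repr x).
Let qmul (x y : quot_alg) := quot_pi (repr x * repr y).
Let qscale (c : k) (x : quot_alg) := quot_pi (c *: repr x).

Let IreprB a : I (repr (quot_pi a) - a).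
Proof. by apply/quot_piP; rewrite quot_reprK. Qed.

Let qaddE a b : qadd (quot_pi a) (quot_pi b) = quot_pi (a + b).
Proof.
apply/quot_piP; rewrite opprD addrACA.
by apply: (pi2_D hI); apply: IreprB.
Qed.

Let qoppE a : qopp (quot_pi a) = quot_pi (- a).
Proof. by apply/quot_piP; rewrite -opprD; apply/IN/IreprB. Qed.

Let qmulE a b : qmul (quot_pi a) (quot_pi b) = quot_pi (a * b).
Proof.
apply/quot_piP.
set a' := repr _; set b' := repr _.
have -> : a' * b' - a * b = (a' - a) * b' + a * (b' - b).
  by rewrite mulrBl mulrBr addrA subrK.
by apply: (pi2_D hI); [apply: (pi2_Mr hI)|apply: (pi2_Ml hI)]; apply: IreprB.
Qed.

Let qscaleE c a : qscale c (quot_pi a) = quot_pi (c *: a).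
Proof.
apply/quot_piP; rewrite -scalerBr -mulr_algl.
by apply: (pi2_Ml hI); apply: IreprB.
Qed.

Let qW (P : quot_alg -> Prop) : (forall a, P (quot_pi a)) -> forall x, P x.
Proof. by move=> h x; rewrite -(quot_reprK x). Qed.

Fact qaddA : associative qadd.
Proof. by elim/qW=> a; elim/qW=> b; elim/qW=> c; rewrite !qaddE addrA. Qed.
Fact qaddC : commutative qadd.
Proof. by elim/qW=> a; elim/qW=> b; rewrite !qaddE addrC. Qed.
Fact qadd0 : left_id (quot_pi 0) qadd.
Proof. by elim/qW=> a; rewrite !qaddE add0r. Qed.
Fact qaddN : left_inverse (quot_pi 0) qopp qadd.
Proof. by elim/qW=> a; rewrite qoppE qaddE addNr. Qed.

HB.instance Definition _ := GRing.isZmodule.Build quot_alg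
  qaddA qaddC qadd0 qaddN.

Fact qmulA : associative qmul.
Proof. by elim/qW=> a; elim/qW=> b; elim/qW=> c; rewrite !qmulE mulrA. Qed.
Fact qmul1 : left_id (quot_pi 1) qmul.
Proof. by elim/qW=> a; rewrite !qmulE mul1r. Qed.
Fact qmulr1 : right_id (quot_pi 1) qmul.
Proof. by elim/qW=> a; rewrite !qmulE mulr1. Qed.
Fact qmulDl : left_distributive qmul +%R.
Proof.
elim/qW=> a; elim/qW=> b; elim/qW=> c.
by rewrite /GRing.add /= !(qaddE, qmulE) mulrDl.
Qed.
Fact qmulDr : right_distributive qmul +%R.
Proof.
elim/qW=> a; elim/qW=> b; elim/qW=> c.
by rewrite /GRing.add /= !(qaddE, qmulE) mulrDr.
Qed.
Fact qone_neq0 : quot_pi 1 != 0.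
Proof. by apply/eqP => /quot_piP; rewrite subr0; apply: (pi2_1 hI). Qed.

HB.instance Definition _ := GRing.Zmodule_isNzRing.Build quot_alg
  qmulA qmul1 qmulr1 qmulDl qmulDr qone_neq0.

Fact qscaleA a b x : qscale a (qscale b x) = qscale (a * b) x.
Proof. by elim/qW: x => x; rewrite !qscaleE scalerA. Qed.
Fact qscale1 : left_id 1 qscale.
Proof. by elim/qW=> a; rewrite qscaleE scale1r. Qed.
Fact qscaleDr : right_distributive qscale +%R.
Proof.
move=> c; elim/qW=> a; elim/qW=> b.
by rewrite /GRing.add /= !(qaddE, qscaleE) scalerDr.
Qed.
Fact qscaleDl x : {morph qscale^~ x : a b / a + b}.
Proof.
move=> a b /=; elim/qW: x => x.
by rewrite [in RHS]/GRing.add /= !(qaddE, qscaleE) scalerDl.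
Qed.

HB.instance Definition _ := GRing.Zmodule_isLmodule.Build k quot_alg
  qscaleA qscale1 qscaleDr qscaleDl.

Fact qscaleAl (c : k) (x y : quot_alg) : c *: (x * y) = (c *: x) * y.
Proof.
elim/qW: x => x; elim/qW: y => y.
by rewrite /GRing.mul /GRing.scale /= !(qmulE, qscaleE) scalerAl.
Qed.
HB.instance Definition _ := GRing.Lmodule_isLalgebra.Build k quot_alg qscaleAl.

Fact qscaleAr (c : k) (x y : quot_alg) : c *: (x * y) = x * (c *: y).
Proof.
elim/qW: x => x; elim/qW: y => y.
by rewrite /GRing.mul /GRing.scale /= !(qmulE, qscaleE) scalerAr.
Qed.
HB.instance Definition _ := GRing.Lalgebra_isAlgebra.Build k quot_alg qscaleAr.

Lemma quot_piB : zmod_morphism quot_pi.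
Proof. by move=> a b; rewrite -qaddE -qoppE. Qed.
Lemma quot_piM : monoid_morphism quot_pi.
Proof. by split=> // a b; rewrite -qmulE. Qed.
Lemma quot_piZ : scalable quot_pi.
Proof. by move=> c a; rewrite -qscaleE. Qed.
HB.instance Definition _ := GRing.isZmodMorphism.Build A quot_alg quot_pi
  quot_piB.
HB.instance Definition _ := GRing.isMonoidMorphism.Build A quot_alg quot_pi
  quot_piM.
HB.instance Definition _ := GRing.isScalable.Build k A quot_alg *:%R quot_pi
  quot_piZ.

End QuotientAlgebra.

Inductive ideal_gen (k : comNzRingType) (A : algType k) (S : A -> Prop) :
  A -> Prop :=
| IdealGen a of S a : ideal_gen S a
| IdealGen0 : ideal_gen S 0
| IdealGenD a b of ideal_gen S a & ideal_gen S b : ideal_gen S (a + b)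
| IdealGenMl a b of ideal_gen S b : ideal_gen S (a * b)
| IdealGenMr a b of ideal_gen S a : ideal_gen S (a * b).

Lemma proper_ideal_gen (k : comNzRingType) (A : algType k) (S : A -> Prop) :
  ~ ideal_gen S 1 -> proper_ideal2 (ideal_gen S).
Proof.
by move=> h; split=> //; [apply: IdealGen0 | apply: IdealGenD
  | apply: IdealGenMl | apply: IdealGenMr].
Qed.

(* Free associative algebra: words in I as monomials. *)
Definition free_alg (k : comNzRingType) (I : choiceType) := {malg k[{fmonom I}]}.

Section FreeAlgebra.
Variables (k : comNzRingType) (I : choiceType).

HB.instance Definition _ := GRing.Lalgebra.on (free_alg k I).

Fact free_algAr (c : k) (p q : free_alg k I) : c *: (p * q) = p * (c *: q).
Proof.
have malgCC (q' : {malg k[{fmonom I}]}) : c%:MP * q' = q' * c%:MP.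
  rewrite !malgM_def fgmulUg fgmulgU; apply: eq_bigr => m _.
  by rewrite mul1m mulm1 mulrC.
change (c *: (p * q : {malg k[{fmonom I}]}) =
        (p : {malg k[{fmonom I}]}) * (c *: (q : {malg k[{fmonom I}]}))).
by rewrite -!mul_malgC !mulrA malgCC.
Qed.

HB.instance Definition _ :=
  GRing.Lalgebra_isAlgebra.Build k (free_alg k I) free_algAr.

Definition fgen (i : I) : free_alg k I := << fmu i >>.

(* The value of a noncommutative polynomial under the substitution i |-> a i. *)
Definition feval (A : algType k) (a : I -> A) (p : free_alg k I) : A :=
  \sum_(m <- msupp p) p@_m *: \prod_(i <- fmonom_val m) a i.

Section Feval.
Variables (A : algType k) (a : I -> A).

Let h (m : {fmonom I}) : A := \prod_(i <- fmonom_val m) a i.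

Fact fprod_mmorphism : mmorphism h.
Proof.
by split=> [m m'|]; rewrite /h ?fm1 ?big_nil // fmM big_cat.
Qed.
HB.instance Definition _ := isMultiplicative.Build {fmonom I} A h
  fprod_mmorphism.

Let fevalE p : feval a p = mmap (in_alg A) h p.
Proof. by apply: eq_bigr => m _; rewrite mulr_algl. Qed.

Fact feval_zmod_morphism : zmod_morphism (feval a).
Proof. by move=> p q; rewrite !fevalE raddfB. Qed.

Fact feval_monoid_morphism : monoid_morphism (feval a).
Proof.
have hC : forall (g : {malg k[{fmonom I}]}) m m',
    GRing.comm (in_alg A g@_m) (h m').
  by move=> g m m'; rewrite /GRing.comm mulr_algl mulr_algr.
have [hM h1] := commr_mmap_is_multiplicative hC.
by split=> [|p q]; rewrite !fevalE ?hM ?h1.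
Qed.

Fact feval_scalable : scalable (feval a).
Proof. by move=> c p; rewrite !fevalE mmapZ mulr_algl. Qed.

HB.instance Definition _ := GRing.isZmodMorphism.Build (free_alg k I) A
  (feval a) feval_zmod_morphism.
HB.instance Definition _ := GRing.isMonoidMorphism.Build (free_alg k I) A
  (feval a) feval_monoid_morphism.
HB.instance Definition _ := GRing.isScalable.Build k (free_alg k I) A *:%R
  (feval a) feval_scalable.

Lemma feval_fgen i : feval a (fgen i) = a i.
Proof. by rewrite fevalE mmapU /= scale1r mul1r /h fmU big_seq1. Qed.

End Feval.
End FreeAlgebra.

(* The algebra k<I> / (l - r : rel l r). *)
Section Presentation.
Variables (k : comNzRingType) (I : choiceType).
Variable rel : free_alg k I -> free_alg k I -> Prop.

Definition relators (p : free_alg k I) : Prop :=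
  exists l r, rel l r /\ p = l - r.

Definition presentation_ideal := ideal_gen relators.

Lemma feval_presentation_ideal (A : algType k) (a : I -> A) :
    (forall l r, rel l r -> feval a l = feval a r) ->
  forall p, presentation_ideal p -> feval a p = 0.
Proof.
move=> ha p; elim=> {p} [p [l [r [/ha e ->]]]||p q _ p0 _ q0|p q _ q0|p q _ p0].
- by rewrite rmorphB /= e subrr.
- by rewrite rmorph0.
- by rewrite rmorphD /= p0 q0 addr0.
- by rewrite rmorphM /= q0 mulr0.
- by rewrite rmorphM /= p0 mul0r.
Qed.

Lemma presentation_proper (a : I -> k^o) :
    (forall l r, rel l r -> feval a l = feval a r) ->
  proper_ideal2 presentation_ideal.
Proof.
move=> /feval_presentation_ideal ha; apply: proper_ideal_gen => /ha /eqP.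
by rewrite rmorph1 oner_eq0.
Qed.

End Presentation.

(* The double ~D of the Jordan plane. *)
Inductive dgen := Du | Dv | Dzeta | Dg | Dginv | Dx | Dy.

Definition dgen_code (a : dgen) : nat :=
  match a with
  | Du => 0 | Dv => 1 | Dzeta => 2 | Dg => 3 | Dginv => 4 | Dx => 5 | Dy => 6
  end.
Definition dgen_decode (n : nat) : dgen :=
  nth Dy [:: Du; Dv; Dzeta; Dg; Dginv; Dx] n.
Fact dgen_codeK : cancel dgen_code dgen_decode.
Proof. by case. Qed.
HB.instance Definition _ := Choice.copy dgen (can_type dgen_codeK).

Section Double.
Variable k : fieldType.

Definition double_relations (F : algType k) (u v zeta g ginv x y : F) :
    seq (F * F) :=
  [:: (g * ginv, 1);
      (ginv * g, 1);
      (g * x, x * g);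
      (g * y, y * g + x * g);
      (y * x, x * y - 2%:R^-1 *: x ^+ 2);
      (v * zeta, zeta * v + v);
      (u * zeta, zeta * u + u);
      (v * u, u * v - 2%:R^-1 *: u ^+ 2);
      (zeta * y, y * zeta + y);
      (zeta * x, x * zeta + x);
      (v * g, g * v + g * u);
      (u * g, g * u);
      (v * x, x * v + (1 - g) + x * u);
      (u * x, x * u);
      (u * y, y * u + (1 - g));
      (v * y, y * v - g * zeta + y * u);
      (zeta * g, g * zeta)].

Definition double_rel (l r : free_alg k dgen) : Prop :=
  (l, r) \in double_relations (fgen k Du) (fgen k Dv) (fgen k Dzeta)
    (fgen k Dg) (fgen k Dginv) (fgen k Dx) (fgen k Dy).

Let counit_relations (F : algType k) (f : F -> k)
    (u v zeta g ginv x y : F) :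
    {morph f : a b / a + b} -> {morph f : a / - a} -> {morph f : a b / a * b} ->
    f 1 = 1 -> (forall c a, f (c *: a) = c * f a) ->
    f u = 0 -> f v = 0 -> f zeta = 0 -> f g = 1 -> f ginv = 1 -> f x = 0 ->
    f y = 0 ->
  forall l r, (l, r) \in double_relations u v zeta g ginv x y -> f l = f r.
Proof.
move=> fD fN fM f1 fZ fu fv fz fg fi fx fy l r; rewrite !inE.
have P (p q : F) : f p = f q -> (l, r) == (p, q) -> f l = f r.
  by move=> ? /eqP[-> ->].
by do ![case/orP]; apply: P; rewrite ?(expr2, fD, fN, fM, fZ, f1)
  ?(fu, fv, fz, fg, fi, fx, fy)
  ?(mulr0, mul0r, mulr1, subrr, addr0, subr0).
Qed.

(* The counit of ~D. *)
Let counit (i : dgen) : k^o := if i is (Dg | Dginv) then 1 else 0.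

Fact double_proper : proper_ideal2 (presentation_ideal double_rel).
Proof.
apply: (@presentation_proper _ _ _ counit) => l r; pose e : {lrmorphism free_alg k dgen -> k^o} := feval counit.
apply: counit_relations; rewrite ?feval_fgen //.
- exact: (rmorphD e).
- exact: (rmorphN e).
- exact: (rmorphM e).
- exact: (rmorph1 e).
- exact: (feval_scalable counit).
Qed.

Definition double_alg := quot_alg double_proper.
HB.instance Definition _ := GRing.Algebra.on double_alg.

End Double.

(* Laurent polynomials k[T^{+-1}] = k<T, T'> / (T T' = 1 = T' T), where T is
   the generator indexed by true and T' = T^-1 the one indexed by false. *)
Section Laurent.
Variable k : fieldType.

Local Notation T := (fgen k true).
Local Notation Tinv := (fgen k false).

Definition laurent_relations : seq (free_alg k bool * free_alg k bool) :=
  [:: (T * Tinv, 1); (Tinv * T, 1)].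

Definition laurent_rel (l r : free_alg k bool) : Prop :=
  (l, r) \in laurent_relations.

Let one_bool (b : bool) : k^o := 1.

Fact laurent_rel_feval l r :
  laurent_rel l r -> feval one_bool l = feval one_bool r.
Proof.
rewrite /laurent_rel !inE => /orP[] /eqP[-> ->];
  by rewrite rmorphM rmorph1 /= !feval_fgen mulr1.
Qed.

Fact laurent_proper : proper_ideal2 (presentation_ideal laurent_rel).
Proof. exact: presentation_proper laurent_rel_feval. Qed.

Definition laurent := quot_alg laurent_proper.
HB.instance Definition _ := GRing.Algebra.on laurent.

Fact laurent_augmentation : exists e : {lrmorphism laurent -> k^o}, True.
Proof.
pose e (p : laurent) : k^o := feval one_bool (repr p).
have eE p : e (quot_pi _ p) = feval one_bool p.
  apply/eqP; rewrite -subr_eq0 -rmorphB /=; apply/eqP.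
  apply: (feval_presentation_ideal laurent_rel_feval).
  by apply/(quot_piP laurent_proper); rewrite quot_reprK.
have W (P : laurent -> Prop) : (forall a, P (quot_pi _ a)) -> forall x, P x.
  by move=> h x; rewrite -(quot_reprK x).
have eB : zmod_morphism e.
  by elim/W=> a; elim/W=> b; rewrite -rmorphB !eE rmorphB.
have eM : monoid_morphism e.
  split; first by rewrite -[1](rmorph1 (quot_pi laurent_proper)) eE rmorph1.
  by elim/W=> a; elim/W=> b; rewrite -rmorphM !eE rmorphM.
have eZ : scalable e.
  by move=> c; elim/W=> a; rewrite -linearZ !eE linearZ.
pose m1 := GRing.isZmodMorphism.Build _ _ e eB.
pose m2 := GRing.isMonoidMorphism.Build _ _ e eM.
pose m3 := GRing.isScalable.Build _ _ _ _ e eZ.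
pose f : {lrmorphism laurent -> k^o} := HB.pack e m1 m2 m3.
by exists f.
Qed.

End Laurent.

(* A (x) B, presented by the symbols a (x) b, which are bilinear in (a, b),
   with unit 1 (x) 1 and product (a (x) b)(a' (x) b') = aa' (x) bb'. *)
Section TensorProduct.
Variables (k : fieldType) (A B : algType k).

Local Notation "a ⊗ b" := (fgen k ((a, b) : A * B)) (at level 35).

Inductive tensor_rel : free_alg k (A * B)%type -> free_alg k (A * B)%type -> Prop :=
| TensorDl a a' b : tensor_rel ((a + a') ⊗ b) (a ⊗ b + a' ⊗ b)
| TensorDr a b b' : tensor_rel (a ⊗ (b + b')) (a ⊗ b + a ⊗ b')
| TensorZl c a b : tensor_rel ((c *: a) ⊗ b) (c *: (a ⊗ b))
| TensorZr c a b : tensor_rel (a ⊗ (c *: b)) (c *: (a ⊗ b))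
| TensorM a a' b b' : tensor_rel ((a ⊗ b) * (a' ⊗ b')) ((a * a') ⊗ (b * b'))
| Tensor1 : tensor_rel (1 ⊗ 1) 1.

Lemma tensor_proper (eA : {lrmorphism A -> k^o}) (eB : {lrmorphism B -> k^o}) :
  proper_ideal2 (presentation_ideal tensor_rel).
Proof.
apply: (@presentation_proper _ _ _ (fun ab => eA ab.1 * eB ab.2)) => l r [].
- by move=> a a' b; rewrite rmorphD /= !feval_fgen rmorphD mulrDl.
- by move=> a b b'; rewrite rmorphD /= !feval_fgen rmorphD mulrDr.
- by move=> c a b; rewrite linearZ /= !feval_fgen linearZ /= scalerAl.
- by move=> c a b; rewrite linearZ /= !feval_fgen linearZ /= scalerAr.
- by move=> a a' b b'; rewrite rmorphM /= !feval_fgen !rmorphM /= mulrACA.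
- by rewrite rmorph1 feval_fgen !rmorph1 mulr1.
Qed.

Definition tensor_alg (h : proper_ideal2 (presentation_ideal tensor_rel)) :=
  quot_alg h.

End TensorProduct.

(* k[T^{+-1}] (x) k[X_1, ..., X_n] *)
Section LaurentTensorMpoly.
Variables (k : fieldType) (n : nat).

Fact laurent_mpoly_proper :
  proper_ideal2
    (presentation_ideal (@tensor_rel k (laurent k) ({mpoly k[n]}))).
Proof.
have [e _] := laurent_augmentation k.
pose f (p : {mpoly k[n]}) : k^o := p@_mone.
have fM : monoid_morphism f.
  by split=> [|p q]; [apply: (rmorph1 (mcoeff mone))|apply: (rmorphM (mcoeff mone))].
pose m1 := GRing.isZmodMorphism.Build _ _ f (raddfB (mcoeff mone)).
pose m2 := GRing.isMonoidMorphism.Build _ _ f fM.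
pose m3 := GRing.isScalable.Build k _ k^o *:%R f (fun c p => mcoeffZ c p mone).
pose g : {lrmorphism {mpoly k[n]} -> k^o} := HB.pack f m1 m2 m3.
exact: tensor_proper e g.
Qed.

Definition laurent_mpoly : algType k := tensor_alg laurent_mpoly_proper.

End LaurentTensorMpoly.

Record filtration (k : comNzRingType) (A : algType k) := Filtration {
  fil :> nat -> A -> Prop;
  fil0 : forall n, fil n 0;
  filD : forall n a b, fil n a -> fil n b -> fil n (a + b);
  filZ : forall n c a, fil n a -> fil n (c *: a);
  filS : forall n a, fil n a -> fil n.+1 a;
  fil1 : fil 0%N 1;
  filM : forall m n a b, fil m a -> fil n b -> fil (m + n)%N (a * b) }.

Definition exhaustive (k : comNzRingType) (A : algType k) (F : filtration A) :=
  forall a, exists n, F n a.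

Section AssociatedGraded.
Variables (k : comNzRingType) (A : algType k) (F : filtration A).

Let filB n a b : F n a -> F n b -> F n (a - b).
Proof. by move=> Fa Fb; apply: filD => //; rewrite -scaleN1r; apply: filZ. Qed.

Let fil_le m n a : (m <= n)%N -> F m a -> F n a.
Proof.
by move=> /subnK <- Fa; elim: (n - m)%N => // i; rewrite addSn; apply: filS.
Qed.

Let fil_sum n (I : Type) (r : seq I) (P : pred I) (f : I -> A) :
  (forall i, P i -> F n (f i)) -> F n (\sum_(i <- r | P i) f i).
Proof.
by move=> h; apply: (big_ind (fun a => F n a)) => //; [apply: fil0|apply: filD].
Qed.

(* gr A = \bigoplus_n F_n / F_(n-1) is built as the quotient of
   \bigoplus_n F_n t^n, a subring of A[t], by its ideal
   \bigoplus_n F_(n-1) t^n, with F_(-1) = 0. *)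
Definition rees_pred : {pred {poly A}} := fun p => `[< forall n, F n p`_n >].

Fact rees_subring_closed : subring_closed rees_pred.
Proof.
split=> [|p q /asboolP Fp /asboolP Fq|p q /asboolP Fp /asboolP Fq];
  apply/asboolP => n.
- by rewrite coef1; case: n => [|n]; [apply: fil1|apply: fil0].
- by rewrite coefB; apply: filB.
- rewrite coefM; apply: fil_sum => i _.
  by rewrite -{1}(subnKC (leq_ord i)); apply: filM.
Qed.

HB.instance Definition _ := GRing.isSubringClosed.Build {poly A} rees_pred
  rees_subring_closed.

Record rees := Rees { rees_val : {poly A}; _ : rees_val \in rees_pred }.

HB.instance Definition _ := [isSub for rees_val].
HB.instance Definition _ := [Choice of rees by <:].
HB.instance Definition _ := [SubChoice_isSubNzRing of rees by <:].

Fact rees_fil (p : rees) n : F n (rees_val p)`_n.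
Proof. by case: p => p /= /asboolP. Qed.

Fact rees_scale_subproof (c : k) (p : rees) :
  (c%:A : A) *: rees_val p \in rees_pred.
Proof.
apply/asboolP => n; rewrite coefZ mulr_algl; apply: filZ; exact: rees_fil.
Qed.

Definition rees_scale (c : k) (p : rees) : rees := Rees (rees_scale_subproof c p).

Fact rees_scaleA a b p : rees_scale a (rees_scale b p) = rees_scale (a * b) p.
Proof. by apply: val_inj; rewrite /= scalerA -scalerAl mul1r scalerA. Qed.
Fact rees_scale1 : left_id 1 rees_scale.
Proof. by move=> p; apply: val_inj; rewrite /= !scale1r. Qed.
Fact rees_scaleDr : right_distributive rees_scale +%R.
Proof. by move=> c p q; apply: val_inj; rewrite /= scalerDr. Qed.
Fact rees_scaleDl p : {morph rees_scale^~ p : a b / a + b}.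
Proof. by move=> a b; apply: val_inj; rewrite /= !scalerDl. Qed.
HB.instance Definition _ := GRing.Zmodule_isLmodule.Build k rees
  rees_scaleA rees_scale1 rees_scaleDr rees_scaleDl.

Fact rees_scaleAl (c : k) (p q : rees) : c *: (p * q) = (c *: p) * q.
Proof. by apply: val_inj; rewrite /= -scalerAl. Qed.
HB.instance Definition _ := GRing.Lmodule_isLalgebra.Build k rees rees_scaleAl.

Fact rees_scaleAr (c : k) (p q : rees) : c *: (p * q) = p * (c *: q).
Proof.
apply: val_inj => /=; apply/polyP => n.
rewrite coefZ !coefM mulr_sumr; apply: eq_bigr => i _.
by rewrite coefZ !mulr_algl scalerAr.
Qed.
HB.instance Definition _ := GRing.Lalgebra_isAlgebra.Build k rees rees_scaleAr.

Definition fil_pred (n : nat) (a : A) : Prop :=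
  if n is n'.+1 then F n' a else a = 0.

Definition gr_ideal (p : rees) : Prop := forall n, fil_pred n (rees_val p)`_n.

Fact gr_ideal_proper : proper_ideal2 gr_ideal.
Proof.
have D n a b : fil_pred n a -> fil_pred n b -> fil_pred n (a + b).
  by case: n => [-> ->|n]; [rewrite /= addr0|apply: filD].
have sum n (r : seq 'I_n) (P : pred 'I_n) m f :
    (forall i, fil_pred m (f i)) -> fil_pred m (\sum_(i <- r | P i) f i).
  move=> h; apply: (big_ind (fil_pred m)) => //; last exact: D.
  by case: (m) => //= j; apply: fil0.
have Ml m n a b : F m a -> fil_pred n b -> fil_pred (m + n)%N (a * b).
  case: n => [|n] Fa; first by move=> ->; rewrite mulr0; case: (m + 0)%N => //= j; apply: fil0.
  by rewrite addnS; apply: filM.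
have Mr m n a b : fil_pred m a -> F n b -> fil_pred (m + n)%N (a * b).
  case: m => [|m]; first by move=> -> _; rewrite mul0r; case: (0 + n)%N => //= j; apply: fil0.
  by rewrite addSn; apply: filM.
split.
- by case=> [|n] /=; rewrite coef0 //; apply: fil0.
- by move=> p q hp hq n; rewrite /= coefD; apply: D.
- move=> p q hq n; rewrite /= coefM; apply: sum => i.
  by rewrite -{1}(subnKC (leq_ord i)); apply: Ml => //; apply: rees_fil.
- move=> p q hp n; rewrite /= coefM; apply: sum => i.
  by rewrite -{1}(subnKC (leq_ord i)); apply: Mr => //; apply: rees_fil.
- by move=> /(_ 0%N) /= /eqP; rewrite coef1 oner_eq0.
Qed.

Definition gr := quot_alg gr_ideal_proper.
HB.instance Definition _ := GRing.Algebra.on gr.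

End AssociatedGraded.

Definition left_ideal (R : nzRingType) (J : R -> Prop) :=
  [/\ J 0, forall a b, J a -> J b -> J (a + b) & forall r a, J a -> J (r * a)].

Definition left_noetherian (R : nzRingType) :=
  forall J : nat -> R -> Prop,
    (forall n, left_ideal (J n)) -> (forall n a, J n a -> J n.+1 a) ->
  exists N, forall n a, (N <= n)%N -> J n a -> J N a.

(* Left ideals of the converse ring R^c are the right ideals of R. *)
Definition noetherian (R : nzRingType) :=
  left_noetherian R /\ left_noetherian R^c.

Definition PI_algebra (k : comNzRingType) (A : algType k) :=
  exists (n : nat) (f : free_alg k 'I_n), f != 0 /\
    forall a : 'I_n -> A, feval a f = 0.

Definition alg_iso (k : comNzRingType) (A B : algType k) :=
  exists f : {lrmorphism A -> B}, bijective f.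

(* Main.v *)
Require Import Defs.
From HB Require Import structures.
From mathcomp Require Import all_boot all_order all_algebra.
From mathcomp Require Import mpoly.
From mathcomp Require Import finmap boolp monalg.
From mathcomp Require Import functions perm.
From mathcomp Require Import ring zify.

Set Implicit Arguments.
Unset Strict Implicit.
Unset Printing Implicit Defensive.

Import GRing.Theory.
Local Open Scope ring_scope.

(** The double of the Jordan plane is a smash product in disguise.  Put
    [t = g^-1], [X = t x] and [e = y t].  Then [g], [t], [X], [u] generate a
    commutative algebra [B] of Laurent polynomials, and [e], [v], [zeta] span a
    copy of sl2, with [e v - v e = zeta], [zeta e - e zeta = e] and
    [zeta v - v zeta = - v], which acts on [B] by derivations: [e] by
    [1/2 X^2 d/dX + t X d/dt + (1 - t) d/du], [zeta] by
    [X d/dX - u d/du], and [v] by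
    [(t - 1) d/dX - t u d/dt - 1/2 u^2 d/du].  The seventeen relations of the
    double are equivalent to these relations ([smash_double],
    [double_smash]), so the double is [B # U(sl2)].

    Filter it by the number of letters [e], [v], [zeta] in a word.  A bracket of
    two letters has smaller weight than their product ([letter_commutator]), so
    the associated graded algebra is commutative and is a quotient of
    [k[T,T^-1] (x) k[X_1, ..., X_5]].  That nothing more is killed is the
    linear independence of the ordered monomials
    [t^i X^a u^b e^c v^d zeta^f], which is seen on a representation:
    [B # U(sl2)] acts on [B (x) U(sl2)], and writing [U(sl2)] in the PBW order
    [e], [v], [zeta] turns this into an action by explicit differential
    operators on Laurent polynomials in [t] over a polynomial ring [R] in five
    variables ([smash_representation]), where an ordered monomial sends 1 to the
    monomial of the same exponents.  Formal series [int -> R] are as good as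
    Laurent polynomials for this purpose, and need no finiteness.
    Functionals reading off coefficients then separate the monomials in the
    graded algebra ([gr_iso]).  Since the graded algebra is a domain, so is the
    double ([filtered_domain]).

    In characteristic [p], [ad(a)^p = ad(a^p)].  Computing on the generators,
    [ad(e)^p = 0] and [ad(zeta)^p = ad(zeta)]; the automorphism
    exchanging [e] with [v] and [X] with [- u] settles [v].
    Hence [g^p], [t^p], [X^p], [u^p], [e^p], [v^p] and [zeta^p - zeta] are
    central, and the double is spanned over a finitely generated central
    subalgebra by the finitely many ordered monomials with exponents below [p]
    ([finite_over_center]).  It is noetherian on both sides by Hilbert's basis
    theorem, and it satisfies a standard polynomial identity because there are
    fewer generators than arguments ([finite_over_center_PI]). *)

(** * Algebra morphisms out of presented algebras *)

Lemma malgUZ (K : choiceType) (R : nzRingType) (c : R) (m : K) :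
  << c *g m >> = c *: << m >> :> {malg R[K]}.
Proof. by apply/malgP => n; rewrite mcoeffZ !mcoeffU mulrnAr mulr1. Qed.

Section Presentations.
Variables (k : comNzRingType).

Lemma free_alg_ind (I : choiceType) (P : free_alg k I -> Prop) :
    P 1 -> (forall p q, P p -> P q -> P (p + q)) ->
    (forall p q, P p -> P q -> P (p * q)) ->
    (forall c p, P p -> P (c *: p)) -> (forall i, P (fgen k i)) ->
  forall p, P p.
Proof.
move=> P1 PD PM PZ Pg p.
have P0 : P 0 by rewrite -(scale0r 1); apply: PZ.
have Pw (m : {fmonom I}) : P (<< m >> : free_alg k I).
  case: m => s; elim: s => [|i s IHs].
    suff -> : FMonom [::] = mone :> {fmonom I} by exact: P1.
    by apply: val_inj; rewrite /= fm1.
  suff -> : << FMonom (i :: s) >> =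
      (fgen k i) * << FMonom s >> :> free_alg k I by apply: PM.
  rewrite /fgen [RHS](_ : _ = << mmul (fmu i) (FMonom s) >>); last first.
    by rewrite malgM_def fgmulUU mulr1.
  by congr << _ >>; apply: val_inj; rewrite /= fmM fmU.
have -> : p = \sum_(m <- msupp p) mcoeff m p *: << m >> :> {malg k[{fmonom I}]}.
  by rewrite [LHS]monalgE; apply: eq_bigr => m _; apply: malgUZ.
by apply: big_ind => // m _; apply: PZ.
Qed.

(** Generation as an induction principle, the form in which it is used. *)
Definition generated_by (A : algType k) (G : A -> Prop) : Prop :=
  forall P : A -> Prop,
    P 1 -> (forall a b, P a -> P b -> P (a + b)) ->
    (forall a b, P a -> P b -> P (a * b)) -> (forall c a, P a -> P (c *: a)) ->
    (forall a, G a -> P a) ->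
  forall a, P a.

Lemma generated_comm (A : algType k) (G : A -> Prop) :
    generated_by G ->
    (forall a b, G a -> G b -> a * b = b * a) ->
  forall a b : A, a * b = b * a.
Proof.
move=> A_ind GC a b; elim/A_ind: a => [|a a' IH IH'|a a' IH IH'|c a IH|a Ga].
- by rewrite mulr1 mul1r.
- by rewrite mulrDl mulrDr IH IH'.
- by rewrite -mulrA IH' mulrA IH mulrA.
- by rewrite -scalerAl IH scalerAr.
elim/A_ind: b => [|b b' IH IH'|b b' IH IH'|c b IH|b Gb].
- by rewrite mulr1 mul1r.
- by rewrite mulrDl mulrDr IH IH'.
- by rewrite mulrA IH -mulrA IH' mulrA.
- by rewrite -scalerAr IH scalerAl.
- exact: GC.
Qed.

Lemma quot_alg_ind (A : algType k) (I : A -> Prop) (hI : proper_ideal2 I)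
    (P : quot_alg hI -> Prop) :
  (forall a, P (quot_pi hI a)) -> forall z, P z.
Proof. by move=> Pq z; rewrite -(quot_reprK z). Qed.

Variables (I : choiceType) (rel : free_alg k I -> free_alg k I -> Prop).
Variable h : proper_ideal2 (presentation_ideal rel).

Definition pgen (i : I) : quot_alg h := quot_pi h (fgen k i).

Lemma presentation_ind (P : quot_alg h -> Prop) :
    P 1 -> (forall p q, P p -> P q -> P (p + q)) ->
    (forall p q, P p -> P q -> P (p * q)) ->
    (forall c p, P p -> P (c *: p)) -> (forall i, P (pgen i)) ->
  forall p, P p.
Proof.
move=> P1 PD PM PZ Pg; apply: quot_alg_ind => p.
elim/free_alg_ind: p => [|p q|p q|c p|//].
- by rewrite rmorph1.
- by rewrite rmorphD; apply: PD.
- by rewrite rmorphM; apply: PM.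
- by rewrite linearZ; apply: PZ.
Qed.

Lemma presentation_comm :
    (forall i j, pgen i * pgen j = pgen j * pgen i) ->
  forall a b : quot_alg h, a * b = b * a.
Proof.
move=> gC; apply: (@generated_comm (quot_alg h) (fun a => exists i, a = pgen i)).
  move=> P P1 PD PM PZ Pg; apply: (presentation_ind P1 PD PM PZ) => i.
  by apply: Pg; exists i.
by move=> a b [i ->] [j ->].
Qed.

Lemma pgen_rel l r : rel l r -> quot_pi h l = quot_pi h r.
Proof. by move=> lr; apply/quot_piP; apply: IdealGen; exists l, r. Qed.

(** The universal property of [k<I> / (rel)]. *)
Lemma presentation_lift (B : algType k) (a : I -> B) :
    (forall l r, rel l r -> feval a l = feval a r) ->
  exists f : {lrmorphism quot_alg h -> B}, forall i, f (pgen i) = a i.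
Proof.
move=> ha; pose e (p : quot_alg h) : B := feval a (repr p).
have eE p : e (quot_pi _ p) = feval a p.
  apply/eqP; rewrite -subr_eq0 -rmorphB /=; apply/eqP.
  apply: (feval_presentation_ideal ha).
  by apply/(quot_piP h); rewrite quot_reprK.
have eB : zmod_morphism e.
  by elim/quot_alg_ind=> p; elim/quot_alg_ind=> q; rewrite -rmorphB !eE rmorphB.
have eM : monoid_morphism e.
  split; first by rewrite -[1](rmorph1 (quot_pi h)) eE rmorph1.
  by elim/quot_alg_ind=> p; elim/quot_alg_ind=> q; rewrite -rmorphM !eE rmorphM.
have eZ : scalable e.
  by move=> c; elim/quot_alg_ind=> p; rewrite -linearZ !eE linearZ.
pose m1 := GRing.isZmodMorphism.Build _ _ e eB.
pose m2 := GRing.isMonoidMorphism.Build _ _ e eM.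
pose m3 := GRing.isScalable.Build _ _ _ _ e eZ.
pose f : {lrmorphism quot_alg h -> B} := HB.pack e m1 m2 m3.
by exists f => i; rewrite /= /pgen [LHS]eE feval_fgen.
Qed.

End Presentations.

(** * The algebra of linear endomorphisms *)

Section Endomorphisms.
Variables (k : comNzRingType) (V : lmodType k) (v0 : V).
Hypothesis v0_neq0 : v0 != 0.

(** The proof that [v0] is nonzero is a parameter so that the algebra structure,
    which must be nontrivial, can be found from the type alone. *)
Record lend (nz : v0 != 0) :=
  Lend { lend_fun :> V -> V; lend_linear : linear lend_fun }.

Local Notation E := (lend v0_neq0).
HB.instance Definition _ := gen_eqMixin E.
HB.instance Definition _ := gen_choiceMixin E.

Lemma lendP (f g : E) : f =1 g -> f = g.
Proof.
case: f g => f fl [g gl] /= /funext fg; case: _ / fg in gl *.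
by congr Lend; apply: Prop_irrelevance.
Qed.

Fact lend0_subproof : linear (fun _ : V => 0 : V).
Proof. by move=> c v w; rewrite scaler0 addr0. Qed.
Fact lend1_subproof : linear (idfun : V -> V).
Proof. by []. Qed.
Fact lendN_subproof (f : E) : linear (fun v => - f v).
Proof. by move=> c v w; rewrite lend_linear opprD scalerN. Qed.
Fact lendD_subproof (f g : E) : linear (fun v => f v + g v).
Proof. by move=> c v w; rewrite !lend_linear scalerDr addrACA. Qed.
Fact lendM_subproof (f g : E) : linear (fun v => f (g v)).
Proof. by move=> c v w; rewrite !lend_linear. Qed.
Fact lendZ_subproof c (f : E) : linear (fun v => c *: f v).
Proof. by move=> d v w; rewrite lend_linear scalerDr !scalerA mulrC. Qed.

Let e0 : E := Lend _ lend0_subproof.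
Let e1 : E := Lend _ lend1_subproof.
Let eN f : E := Lend _ (lendN_subproof f).
Let eD f g : E := Lend _ (lendD_subproof f g).
Let eM f g : E := Lend _ (lendM_subproof f g).
Let eZ c f : E := Lend _ (lendZ_subproof c f).

Lemma lendfD (f : E) v w : f (v + w) = f v + f w.
Proof. by rewrite -[v]scale1r lend_linear !scale1r. Qed.
Lemma lendf0 (f : E) : f 0 = 0.
Proof. by apply: (addrI (f 0)); rewrite -lendfD !addr0. Qed.
Lemma lendfZ (f : E) c v : f (c *: v) = c *: f v.
Proof. by rewrite -[c *: v]addr0 lend_linear lendf0 addr0. Qed.

Fact lend_addA : associative eD.
Proof. by move=> f g h; apply: lendP => v /=; rewrite addrA. Qed.
Fact lend_addC : commutative eD.
Proof. by move=> f g; apply: lendP => v /=; rewrite addrC. Qed.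
Fact lend_add0 : left_id e0 eD.
Proof. by move=> f; apply: lendP => v /=; rewrite add0r. Qed.
Fact lend_addN : left_inverse e0 eN eD.
Proof. by move=> f; apply: lendP => v /=; rewrite addNr. Qed.
HB.instance Definition _ := GRing.isZmodule.Build E
  lend_addA lend_addC lend_add0 lend_addN.

Fact lend_mulA : associative eM.
Proof. by move=> f g h; apply: lendP. Qed.
Fact lend_mul1 : left_id e1 eM.
Proof. by move=> f; apply: lendP. Qed.
Fact lend_mulr1 : right_id e1 eM.
Proof. by move=> f; apply: lendP. Qed.
Fact lend_mulDl : left_distributive eM +%R.
Proof. by move=> f g h; apply: lendP. Qed.
Fact lend_mulDr : right_distributive eM +%R.
Proof. by move=> f g h; apply: lendP => v /=; rewrite lendfD. Qed.
Fact lend_one_neq0 : e1 != 0.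
Proof. by apply: contraNneq v0_neq0 => /(congr1 (fun f : E => f v0)) /= ->. Qed.
HB.instance Definition _ := GRing.Zmodule_isNzRing.Build E
  lend_mulA lend_mul1 lend_mulr1 lend_mulDl lend_mulDr lend_one_neq0.

Fact lend_scaleA a b x : eZ a (eZ b x) = eZ (a * b) x.
Proof. by apply: lendP => v /=; rewrite scalerA. Qed.
Fact lend_scale1 : left_id 1 eZ.
Proof. by move=> f; apply: lendP => v /=; rewrite scale1r. Qed.
Fact lend_scaleDr : right_distributive eZ +%R.
Proof. by move=> c f g; apply: lendP => v /=; rewrite scalerDr. Qed.
Fact lend_scaleDl x : {morph eZ^~ x : a b / a + b}.
Proof. by move=> a b; apply: lendP => v /=; rewrite scalerDl. Qed.
HB.instance Definition _ := GRing.Zmodule_isLmodule.Build k E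
  lend_scaleA lend_scale1 lend_scaleDr lend_scaleDl.

Fact lend_scaleAl (c : k) (x y : E) : c *: (x * y) = (c *: x) * y.
Proof. exact: lendP. Qed.
HB.instance Definition _ := GRing.Lmodule_isLalgebra.Build k E lend_scaleAl.
Fact lend_scaleAr (c : k) (x y : E) : c *: (x * y) = x * (c *: y).
Proof. by apply: lendP => v /=; rewrite lendfZ. Qed.
HB.instance Definition _ := GRing.Lalgebra_isAlgebra.Build k E lend_scaleAr.

Lemma lendDE (f g : E) v : (f + g) v = f v + g v. Proof. by []. Qed.
Lemma lendME (f g : E) v : (f * g) v = f (g v). Proof. by []. Qed.
Lemma lendNE (f : E) v : (- f) v = - f v. Proof. by []. Qed.
Lemma lendZE c (f : E) v : (c *: f) v = c *: f v. Proof. by []. Qed.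
Lemma lend1E v : (1 : E) v = v. Proof. by []. Qed.
Lemma lendXE (f : E) n v : (f ^+ n) v = iter n f v.
Proof. by elim: n => //= n IHn; rewrite exprS lendME IHn. Qed.

End Endomorphisms.

(** * Noetherian rings *)

Section ChainLemmas.
Variables (T : Type) (J : nat -> T -> Prop).
Hypothesis JS : forall n a, J n a -> J n.+1 a.

Lemma chain_le m n a : (m <= n)%N -> J m a -> J n a.
Proof.
by move=> /subnK <- Ja; elim: (n - m)%N => // i; rewrite addSn; apply: JS.
Qed.

End ChainLemmas.

Lemma field_left_noetherian (k : fieldType) : left_noetherian k.
Proof.
move=> J Jid JS.
have [[N [c [Jc c0]]]|noJ] := EM (exists N c, J N c /\ c != 0).
  exists N => n a _ _; have [_ _ JM] := Jid N.
  by rewrite -(divfK c0 a); apply: JM.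
exists 0%N => n a _ Ja; have [J0 _ _] := Jid 0%N.
have [-> //|a0] := eqVneq a 0.
by case: noJ; exists n, a.
Qed.

(** A chain of ideals [J n] in [{poly R}] is controlled by the ideals [L n d] of
    coefficients of degree [d] of polynomials of degree at most [d] in [J n].
    As [L n d] increases in both arguments, the diagonal chain [L n n]
    stabilizes all but finitely many [d] at once; then an element of [J n] is
    reduced to 0 by subtracting elements of a fixed [J K] with the same
    leading coefficient. *)
Theorem hilbert_basis (R : comNzRingType) :
  left_noetherian R -> left_noetherian {poly R}.
Proof.
move=> noethR J Jid JS.
pose L n d c := exists p, [/\ J n p, (size p <= d.+1)%N & p`_d = c].
have Lid n d : left_ideal (L n d).
  have [J0 JD JM] := Jid n; split.
  - by exists 0; rewrite size_poly0 coef0.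
  - move=> a b [p [Jp sp <-]] [q [Jq sq <-]]; exists (p + q).
    split; [exact: JD| |by rewrite coefD].
    by rewrite (leq_trans (size_polyD _ _)) // geq_max sp.
  - move=> r a [p [Jp sp <-]]; exists (r%:P * p).
    split; [exact: JM| |by rewrite coefCM].
    by rewrite mul_polyC (leq_trans (size_scale_leq _ _)).
have LS n d c : L n d c -> L n.+1 d c.
  by case=> p [Jp sp pd]; exists p; split=> //; apply: JS.
have LSd n d c : L n d c -> L n d.+1 c.
  case=> p [Jp sp pd]; exists ('X * p); have [_ _ JM] := Jid n.
  split; [exact: JM| |by rewrite coefXM].
  by rewrite (leq_trans (size_polyMleq _ _)) // size_polyX.
have Lle n m d c : (n <= m)%N -> L n d c -> L m d c.
  exact: (@chain_le _ (fun n => L n d) (fun n => LS n d)).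
have Lled n d e c : (d <= e)%N -> L n d c -> L n e c.
  exact: (@chain_le _ (L n) (LSd n)).
have [N LN] := noethR (fun n => L n n) (fun n => Lid n n)
  (fun n c h => LSd _ _ _ (LS _ _ _ h)).
have [M LM] : exists M, forall d n c, (d < N)%N -> (M <= n)%N -> L n d c ->
    L M d c.
  elim: (N) => [|N' [M LM]]; first by exists 0%N.
  have [M' LM'] := noethR (fun n => L n N') (fun n => Lid n N')
    (fun n => LS n N').
  exists (maxn M M') => d n c; rewrite ltnS leq_eqVlt geq_max.
  case/orP=> [/eqP -> | dN] /andP[Mn Mn'] Lc.
    by apply: (Lle M'); [apply: leq_maxr|apply: LM' Lc].
  by apply: (Lle M); [apply: leq_maxl|apply: LM Lc].
pose K := maxn N M; exists K => n p Kn Jp.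
have [J0 JD JM] := Jid n; have [_ KD _] := Jid K.
elim: {p}(size p) {-2}p (leqnn (size p)) Jp => [|s IHs] p sp Jp.
  by move: sp; rewrite leqn0 size_poly_eq0 => /eqP ->; case: (Jid K).
have Lp : L n s p`_s by exists p.
have [q [Jq sq qs]] : L K s p`_s.
  have [sN|Ns] := ltnP s N.
    apply: (Lle M); first exact: leq_maxr.
    by apply: LM Lp => //; apply: leq_trans Kn; apply: leq_maxr.
  apply: (Lle N); first exact: leq_maxl.
  apply: (Lled _ N) => //; apply: (LN (maxn n s)).
    by rewrite leq_max Ns orbT.
  apply: (Lle n); first exact: leq_maxl.
  by apply: (Lled _ s) => //; apply: leq_maxr.
rewrite -(subrK q p); apply: KD => //; apply: IHs.
  apply/leq_sizeP => i; rewrite leq_eqVlt => /predU1P[<-|si].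
    by rewrite coefB qs subrr.
  by rewrite coefB !nth_default ?subrr //; apply: leq_trans si.
by apply: JD => //; rewrite -mulN1r; apply: JM; apply: chain_le Jq.
Qed.

(** * Algebras finite over a central subring *)

Section CentralSpan.
Variables (C : comNzRingType) (A : nzRingType) (chi : {rmorphism C -> A}).

Inductive cspan (bs : seq A) : A -> Prop :=
| Cspan0 : cspan bs 0
| CspanD c b a of b \in bs & cspan bs a : cspan bs (chi c * b + a).

Lemma cspan_add bs a a' : cspan bs a -> cspan bs a' -> cspan bs (a + a').
Proof.
move=> ha ha'; elim: ha => [|c b a0 hb _ IH]; first by rewrite add0r.
by rewrite -addrA; constructor.
Qed.

Lemma cspan_scale bs c a : cspan bs a -> cspan bs (chi c * a).
Proof.
elim=> [|d b a0 hb _ IH]; first by rewrite mulr0; constructor.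
by rewrite mulrDr mulrA -rmorphM; constructor.
Qed.

Lemma cspan_mem bs b : b \in bs -> cspan bs b.
Proof.
move=> hb; rewrite -[b]addr0 -[b]mul1r -(rmorph1 chi).
by constructor=> //; constructor.
Qed.

Lemma cspan_sum bs a :
  cspan bs a -> exists c : 'I_(size bs) -> C, a = \sum_i chi (c i) * bs`_i.
Proof.
elim=> [|c b {}a hb _ [d ->]].
  by exists (fun=> 0); rewrite big1 // => i _; rewrite rmorph0 mul0r.
move: (hb); rewrite -index_mem => hi; pose i0 := Ordinal hi.
exists (fun i => (if i == i0 then c else 0) + d i).
under [RHS]eq_bigr do rewrite rmorphD mulrDl.
rewrite big_split /= [in RHS](bigD1 i0) //= eqxx nth_index //.
rewrite [X in _ + X + _]big1 ?addr0 //.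
by move=> i /negbTE ->; rewrite rmorph0 mul0r.
Qed.

Lemma cspan_cons b bs a :
  cspan (b :: bs) a -> exists c, cspan bs (a - chi c * b).
Proof.
elim=> [|c b' {}a]; first by exists 0; rewrite rmorph0 mul0r subr0; constructor.
rewrite inE => /predU1P[->|hb'] _ [d hd].
  by exists (c + d); rewrite rmorphD mulrDl opprD addrACA subrr add0r.
by exists d; rewrite -addrA; constructor.
Qed.

(** Submodules of a finitely generated module over a noetherian ring satisfy the
    ascending chain condition: the coefficients of the first generator form a
    chain of ideals of [C], and the elements free of it lie in the span of fewer
    generators. *)
Lemma cspan_chain bs : left_noetherian C ->
  forall J : nat -> A -> Prop,
    (forall n, J n 0) -> (forall n a b, J n a -> J n b -> J n (a + b)) ->
    (forall n c a, J n a -> J n (chi c * a)) ->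
    (forall n a, J n a -> J n.+1 a) -> (forall n a, J n a -> cspan bs a) ->
  exists N, forall n a, (N <= n)%N -> J n a -> J N a.
Proof.
move=> noethC; elim: bs => [|b bs IHbs] J J0 JD JM JS Jspan.
  exists 0%N => n a _ /Jspan ha; suff -> : a = 0 by [].
  by case: ha => // c b a0; rewrite in_nil.
pose I n c := exists a, J n a /\ cspan bs (a - chi c * b).
have [N1 hN1] : exists N, forall n c, (N <= n)%N -> I n c -> I N c.
  apply: noethC => [n|n c [a [Ja ha]]]; last by exists a; split=> //; apply: JS.
  split.
  - by exists 0; split=> //; rewrite rmorph0 mul0r subr0; constructor.
  - move=> c c' [a [Ja ha]] [a' [Ja' ha']]; exists (a + a').
    split; first exact: JD.
    by rewrite rmorphD mulrDl opprD addrACA; apply: cspan_add.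
  - move=> r c [a [Ja ha]]; exists (chi r * a); split; first exact: JM.
    by rewrite rmorphM -mulrA -mulrBr; apply: cspan_scale.
have [|||||N2 hN2] := IHbs (fun n a => J n a /\ cspan bs a).
- by move=> n; split=> //; constructor.
- by move=> n a a' [? ?] [? ?]; split; [apply: JD|apply: cspan_add].
- by move=> n c a [? ?]; split; [apply: JM|apply: cspan_scale].
- by move=> n a [? ?]; split=> //; apply: JS.
- by move=> n a [].
pose N := maxn N1 N2; exists N => n a Nn Ja.
have [c hc] := cspan_cons (Jspan _ _ Ja).
have N1n : (N1 <= n)%N by apply: leq_trans Nn; apply: leq_maxl.
have N2n : (N2 <= n)%N by apply: leq_trans Nn; apply: leq_maxr.
have [a' [Ja' ha']] : I N1 c by apply: (hN1 n) => //; exists a.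
have JNa' : J N a' by apply: (chain_le JS) Ja'; apply: leq_maxl.
have JN x : J n x -> J n (- x).
  by rewrite -mulN1r -(rmorph1 chi) -rmorphN; apply: JM.
rewrite -(subrK a' a); apply: (JD) => //.
apply: (chain_le JS (leq_maxr N1 N2)).
suff [] : J N2 (a - a') /\ cspan bs (a - a') by [].
apply: (hN2 n) => //; split.
  by apply: JD => //; apply: JN; apply: (chain_le JS) JNa'.
have -> : a - a' = (a - chi c * b) + chi (- 1) * (a' - chi c * b).
  by rewrite rmorphN rmorph1 mulN1r opprB addrA subrK.
by apply: cspan_add => //; apply: cspan_scale.
Qed.

Hypothesis chi_central : forall c a, chi c * a = a * chi c.

Lemma cspan_mul bs bs' a a' : cspan bs a -> cspan bs' a' ->
  cspan [seq b * b' | b <- bs, b' <- bs'] (a * a').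
Proof.
move=> ha ha'; elim: ha => [|c b {}a hb _ IH].
  by rewrite mul0r; constructor.
rewrite mulrDl; apply: cspan_add => //; rewrite -mulrA; apply: cspan_scale.
elim: ha' {IH} => [|c' b' {}a' hb' _ IH'].
  by rewrite mulr0; constructor.
rewrite mulrDr mulrA -chi_central -mulrA; constructor => //.
by apply/allpairsP; exists (b, b').
Qed.

(** Left and right ideals are both submodules over the central ring. *)
Lemma finite_over_center_noetherian bs : left_noetherian C ->
  (forall a, cspan bs a) -> noetherian A.
Proof.
move=> noethC span; split=> J Jid JS;
  apply: (cspan_chain noethC _ _ _ JS (fun n a _ => span a)) => [n|n a b|n c a];
  have [J0 JD JM] := Jid n => //; first exact: JD.
- exact: JM.
- exact: JD.
- by rewrite chi_central; apply: (JM (chi c)).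
Qed.

End CentralSpan.

(** * The standard polynomial *)

Section StandardPolynomial.
Variables (k : comNzRingType).

Definition std_poly N : free_alg k 'I_N :=
  \sum_(s : 'S_N) (-1) ^+ s *: \prod_(i < N) fgen k (s i).

Lemma fgen_prod (I : choiceType) (w : seq I) :
  \prod_(i <- w) fgen k i = << FMonom w >> :> free_alg k I.
Proof.
elim: w => [|i w IHw].
  by rewrite big_nil; congr << _ >>; apply: val_inj; rewrite /= fm1.
rewrite big_cons IHw malgM_def fgmulUU mulr1.
by congr << _ >>; apply: val_inj; rewrite /= fmM fmU.
Qed.

Lemma std_poly_neq0 N : std_poly N != 0.
Proof.
apply/eqP => /(congr1 (mcoeff (FMonom (index_enum 'I_N)))).
rewrite mcoeff0 raddf_sum (bigD1 (1%g : 'S_N)) //=.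
rewrite [X in _ + X]big1 ?addr0 => [|s s1].
  rewrite odd_perm1 scale1r (eq_bigr (fun i => fgen k i)) => [|i _]; last first.
    by rewrite perm1.
  by rewrite fgen_prod mcoeffUU => /eqP; rewrite oner_eq0.
rewrite mcoeffZ -(big_map s xpredT (@fgen k 'I_N)) fgen_prod mcoeffU.
case: eqP => [[] |]; last by rewrite mulr0.
move=> e; case/eqP: s1; apply/permP => i; rewrite perm1.
have : nth i [seq s j | j <- index_enum 'I_N] (index i (index_enum 'I_N)) =
       nth i (index_enum 'I_N) (index i (index_enum 'I_N)) by rewrite e.
by rewrite (nth_map i) ?index_mem ?nth_index ?mem_index_enum.
Qed.

(** Substitute more elements than there are generators over the center and
    expand: the coefficient of a product of generators is the determinant of the
    coordinates along these generators, one of which is repeated, so that two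
    rows are equal. *)
Lemma finite_over_center_PI (A : algType k) (C : comNzRingType)
    (chi : {rmorphism C -> A}) (bs : seq A) :
    (forall c a, chi c * a = a * chi c) -> (forall a, cspan chi bs a) ->
  PI_algebra A.
Proof.
move=> chiC span; pose N := (size bs).+1.
exists N, (std_poly N); split=> [|a]; first exact: std_poly_neq0.
have /fin_all_exists[c ac] i := cspan_sum (span (a i)).
rewrite /std_poly raddf_sum /=.
pose F (s : 'S_N) (J : {ffun 'I_N -> 'I_(size bs)}) :=
  chi ((-1) ^+ s * \prod_i c (s i) (J i)) * \prod_i bs`_(J i).
have -> : \sum_(s : 'S_N) feval a ((-1) ^+ s *: \prod_i fgen k (s i)) =
    \sum_(s : 'S_N) \sum_J F s J.
  apply: eq_bigr => s _.
  rewrite linearZ rmorph_prod /= scaler_sign -mulr_sign.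
  under eq_bigr do rewrite feval_fgen ac.
  rewrite bigA_distr_bigA mulr_sumr; apply: eq_bigr => J _.
  rewrite /F rmorphM rmorph_sign -mulrA; congr (_ * _).
  rewrite rmorph_prod /=.
  elim: (index_enum _) => [|i r IHr]; first by rewrite !big_nil mul1r.
  rewrite !big_cons IHr -!mulrA; congr (_ * _).
  by rewrite !mulrA -rmorph_prod /= chiC.
rewrite exchange_big /= big1 // => J _.
rewrite -mulr_suml -raddf_sum /=.
have [i1 [i2 [i12 Ji]]] : exists i1 i2, i1 != i2 /\ J i1 = J i2.
  have /injectivePn[i1 [i2 i12 Ji]] : ~~ injectiveb J.
    apply/injectiveP => /leq_card; rewrite !card_ord => /leP.
    by rewrite /N; lia.
  by exists i1, i2.
pose M := \matrix_(i, l) c l (J i).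
rewrite [X in chi X](_ : _ = \det M).
  rewrite (determinant_alternate i12) ?rmorph0 ?mul0r // => l.
  by rewrite !mxE Ji.
by apply: eq_bigr => s _; congr (_ * _); apply: eq_bigr => i _; rewrite mxE.
Qed.

End StandardPolynomial.

(** * Symbols in the associated graded algebra *)

Section Symbols.
Variables (k : comNzRingType) (A : algType k) (F : filtration A).

(** The class of [a] in [F n / F n.-1], when [a] is in [F n]. *)
Definition symbol n (a : A) : gr F :=
  quot_pi (gr_ideal_proper F) (insubd (0 : rees F) (a *: 'X^n)).

Lemma rees_monomial n a : F n a -> a *: 'X^n \in rees_pred F.
Proof.
move=> Fa; apply/asboolP => i; rewrite coefZ coefXn.
by case: eqP => [->|_]; rewrite ?mulr1 ?mulr0 //; apply: fil0.
Qed.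

Lemma rees_val_monomial n a : F n a ->
  rees_val (insubd (0 : rees F) (a *: 'X^n)) = a *: 'X^n.
Proof. by move=> Fa; rewrite [LHS]insubdK //; apply: rees_monomial. Qed.

Lemma fil_predB n a b : fil_pred F n a -> fil_pred F n b -> fil_pred F n (a - b).
Proof.
case: n => [-> ->|n Fa Fb]; first by rewrite /= subrr.
by apply: filD => //; rewrite -scaleN1r; apply: filZ.
Qed.

Lemma fil_pred0 n : fil_pred F n 0.
Proof. by case: n => //= n; apply: fil0. Qed.

Lemma quot_gr_eq (p q : rees F) :
  (forall n, fil_pred F n ((rees_val p)`_n - (rees_val q)`_n)) <->
  quot_pi (gr_ideal_proper F) p = quot_pi (gr_ideal_proper F) q.
Proof.
split=> [pq|/(quot_piP (gr_ideal_proper F)) pq n]; last first.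
  by have := pq n; rewrite /= coefB.
by apply/(quot_piP (gr_ideal_proper F)) => n; rewrite /= coefB.
Qed.

Lemma symbol_eq n a b : F n a -> F n b ->
  symbol n a = symbol n b <-> fil_pred F n (a - b).
Proof.
move=> Fa Fb; split=> [/quot_gr_eq/(_ n)|ab].
  by rewrite !rees_val_monomial // !coefZ !coefXn eqxx !mulr1.
apply/quot_gr_eq => i; rewrite !rees_val_monomial // !coefZ !coefXn -mulrBl.
by case: eqP => [->|_]; rewrite ?mulr1 // mulr0; apply: fil_pred0.
Qed.

Lemma symbol0 n : symbol n 0 = 0.
Proof.
rewrite -[RHS](raddf0 (quot_pi (gr_ideal_proper F))); apply/quot_gr_eq => i.
rewrite rees_val_monomial; last exact: fil0.
by rewrite scale0r subrr; apply: fil_pred0.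
Qed.

Lemma symbol_eq0 n a : F n a -> symbol n a = 0 <-> fil_pred F n a.
Proof.
move=> Fa; rewrite -[in X in _ <-> X](subr0 a) -(symbol0 n).
by apply: symbol_eq => //; apply: fil0.
Qed.

Lemma symbolD n a b : F n a -> F n b -> symbol n (a + b) = symbol n a + symbol n b.
Proof.
move=> Fa Fb; rewrite -[RHS]raddfD; congr (quot_pi _ _).
have Fab := filD Fa Fb.
by apply: val_inj; rewrite /= !rees_val_monomial // scalerDl.
Qed.

Lemma symbolZ n c a : F n a -> symbol n (c *: a) = c *: symbol n a.
Proof.
move=> Fa; rewrite -[RHS]linearZ; congr (quot_pi _ _).
have Fca := filZ c Fa.
by apply: val_inj; rewrite /= !rees_val_monomial // scalerA mulr_algl.
Qed.

Lemma symbol1 : symbol 0 1 = 1.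
Proof.
rewrite -[RHS](rmorph1 (quot_pi (gr_ideal_proper F))); congr (quot_pi _ _).
apply: val_inj; rewrite /= rees_val_monomial ?scale1r //; exact: fil1.
Qed.

Lemma symbolM m n a b : F m a -> F n b ->
  symbol m a * symbol n b = symbol (m + n) (a * b).
Proof.
move=> Fa Fb; rewrite -[LHS](rmorphM (quot_pi (gr_ideal_proper F))).
congr (quot_pi _ _); have Fab := filM Fa Fb.
apply: val_inj; rewrite [LHS](rmorphM (val : rees F -> {poly A})) /=.
rewrite !rees_val_monomial // -!mul_polyC exprD polyCM -!mulrA; congr (_ * _).
by rewrite !mulrA -(commr_polyXn b%:P m).
Qed.

Lemma gr_ind (P : gr F -> Prop) :
    (forall z w, P z -> P w -> P (z + w)) ->
    (forall n a, F n a -> P (symbol n a)) ->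
  forall z, P z.
Proof.
move=> PD Psym z; rewrite -(quot_reprK z); move: (repr z) => p {z}.
have -> : p = \sum_(i < size (rees_val p))
    insubd (0 : rees F) ((rees_val p)`_i *: 'X^i).
  apply: val_inj; rewrite raddf_sum /= -[LHS]coefK poly_def.
  by apply: eq_bigr => i _; rewrite rees_val_monomial //; apply: rees_fil.
rewrite raddf_sum; apply: big_ind => [|//|i _]; last first.
  exact/Psym/rees_fil.
by rewrite -(symbol0 0); apply: Psym; apply: fil0.
Qed.

(** A linear form on [A] that kills [F n.-1] reads off a coefficient of the
    degree [n] part of [gr F]. *)
Lemma gr_functional (n : nat) (phi : {linear A -> k^o}) :
    (forall a, fil_pred F n a -> phi a = 0) ->
  exists f : {linear gr F -> k^o},
    forall m a, F m a -> f (symbol m a) = if m == n then phi a else 0.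
Proof.
move=> phi0; pose e (z : gr F) : k^o := phi (rees_val (repr z))`_n.
have eE p : e (quot_pi _ p) = phi (rees_val p)`_n.
  apply/eqP; rewrite -subr_eq0 -raddfB; apply/eqP/phi0.
  by have /quot_gr_eq/(_ n) := quot_reprK (quot_pi (gr_ideal_proper F) p).
have W (P : gr F -> Prop) : (forall a, P (quot_pi _ a)) -> forall x, P x.
  by move=> h x; rewrite -(quot_reprK x).
have eB : zmod_morphism e.
  by elim/W=> p; elim/W=> q; rewrite -raddfB !eE /= coefB raddfB.
have eZ : scalable e.
  move=> c; elim/W=> p; rewrite -linearZ !eE /= coefZ.
  by rewrite mulr_algl linearZ.
pose m1 := GRing.isZmodMorphism.Build _ _ e eB.
pose m2 := GRing.isScalable.Build _ _ _ _ e eZ.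
pose f : {linear gr F -> k^o} := HB.pack e m1 m2.
exists f => m a Fa; rewrite /= [LHS]eE rees_val_monomial // coefZ coefXn.
by rewrite eq_sym; case: eqP => _; rewrite ?mulr1 // mulr0 raddf0.
Qed.

Lemma gr_commutative :
    (forall m n a b, F m a -> F n b -> fil_pred F (m + n) (a * b - b * a)) ->
  forall z w : gr F, z * w = w * z.
Proof.
move=> comm z w; elim/gr_ind: z => [z1 z2 IH1 IH2|m a Fa].
  by rewrite mulrDl mulrDr IH1 IH2.
elim/gr_ind: w => [w1 w2 IH1 IH2|n b Fb]; first by rewrite mulrDl mulrDr IH1 IH2.
rewrite !symbolM // [(n + m)%N]addnC; apply/symbol_eq; last exact: comm.
  exact: filM.
by rewrite addnC; apply: filM.
Qed.

(** The symbols of two nonzero elements in their exact degrees are nonzero, and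
    their product is the symbol of the product. *)
Lemma filtered_domain : exhaustive F ->
    (forall z w : gr F, z * w = 0 -> z = 0 \/ w = 0) ->
  GRing.integral_domain_axiom A.
Proof.
move=> exhF domgr.
have top (a : A) : a != 0 -> exists n, F n a /\ symbol n a <> 0.
  move=> a0; have exa : exists n, `[< F n a >].
    by have [n Fa] := exhF a; exists n; apply/asboolP.
  case: (ex_minnP exa) => n /asboolP Fa nmin; exists n; split=> //.
  move=> /(symbol_eq0 Fa); case: n Fa nmin => [_ _ /eqP|n Fa nmin /= Fna].
    by rewrite (negbTE a0).
  by have := nmin n; rewrite ltnn => h; have := h (introT (asboolP _) Fna).
move=> a b ab0; apply/orP; case: eqVneq => [_|a0]; first by left.
right; apply/negPn/negP => b0.
have [m [Fa sa]] := top a a0; have [n [Fb sb]] := top b b0.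
have : symbol m a * symbol n b = 0 by rewrite symbolM // ab0 symbol0.
by case/domgr.
Qed.

End Symbols.

(** * The double as a smash product *)

Section SmashRelations.
Variables (k : fieldType) (B : algType k).
Implicit Types (u v zeta g t x y X e : B).

(** The relations of [k[g,g^-1,X,u] # U(sl2)], with [t] the inverse of [g]. *)
Record smash_rel g t X u e v zeta : Prop := SmashRel {
  sm_gt : g * t = 1;
  sm_tg : t * g = 1;
  sm_Xt : X * t = t * X;
  sm_ut : u * t = t * u;
  sm_uX : u * X = X * u;
  sm_et : e * t = t * e + t * X;
  sm_eX : e * X = X * e + 2%:R^-1 *: X ^+ 2;
  sm_eu : e * u = u * e + (1 - t);
  sm_zt : zeta * t = t * zeta;
  sm_zX : zeta * X = X * zeta + X;
  sm_zu : zeta * u = u * zeta - u;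
  sm_vt : v * t = t * v - t * u;
  sm_vX : v * X = X * v + (t - 1);
  sm_vu : v * u = u * v - 2%:R^-1 *: u ^+ 2;
  sm_ze : zeta * e = e * zeta + e;
  sm_zv : zeta * v = v * zeta - v;
  sm_ev : e * v = v * e + zeta }.

Definition double_hold u v zeta g t x y :=
  forall l r, (l, r) \in double_relations u v zeta g t x y -> l = r.

Hypothesis two_neq0 : 2%:R != 0 :> k.

Let half2 (a : B) : 2%:R^-1 *: a + 2%:R^-1 *: a = a.
Proof.
have e : 2%:R^-1 + 2%:R^-1 = 1 :> k by rewrite -mulr2n -[_ *+ 2]mulr_natl mulfV.
by rewrite -scalerDl e scale1r.
Qed.

Section Inverse.
Variables (g t X u e v zeta : B).
Hypothesis S : smash_rel g t X u e v zeta.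

Let gK a : g * (t * a) = a. Proof. by rewrite mulrA (sm_gt S) mul1r. Qed.
Let tK a : t * (g * a) = a. Proof. by rewrite mulrA (sm_tg S) mul1r. Qed.
Let Kt a : a * g * t = a. Proof. by rewrite -mulrA (sm_gt S) mulr1. Qed.
Let Kg a : a * t * g = a. Proof. by rewrite -mulrA (sm_tg S) mulr1. Qed.

Lemma commutator_inv a b : a * t = t * a + t * b -> a * g = g * a - b * g.
Proof.
move=> h; have : g * (a * t) * g = g * (t * a + t * b) * g by rewrite h.
rewrite mulrA Kg mulrDr !gK mulrDl => ->.
by rewrite addrK.
Qed.

Lemma sm_Xg : X * g = g * X.
Proof. by rewrite (@commutator_inv _ 0) ?mul0r ?subr0 // mulr0 addr0 (sm_Xt S). Qed.
Lemma sm_ug : u * g = g * u.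
Proof. by rewrite (@commutator_inv _ 0) ?mul0r ?subr0 // mulr0 addr0 (sm_ut S). Qed.
Lemma sm_zg : zeta * g = g * zeta.
Proof. by rewrite (@commutator_inv _ 0) ?mul0r ?subr0 // mulr0 addr0 (sm_zt S). Qed.
Lemma sm_eg : e * g = g * e - g * X.
Proof. by rewrite -sm_Xg; apply: commutator_inv; apply: sm_et S. Qed.
Lemma sm_vg : v * g = g * v + g * u.
Proof.
rewrite -sm_ug -[u * g]opprK -mulNr; apply: commutator_inv.
by rewrite (sm_vt S) mulrN.
Qed.

(** The change of generators is [x = g X] and [y = e g]. *)
Lemma smash_double : double_hold u v zeta g t (g * X) (e * g).
Proof.
have [hgt htg hXt hut huX het heX heu hzt hzX hzu hvt hvX hvu hze hzv hev] := S.
move=> l r; rewrite !inE.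
do ![case/orP]; case/eqP => -> -> //.
- by rewrite -!mulrA sm_Xg.
- by rewrite mulrA -mulrDl -sm_Xg; congr (_ * _); rewrite sm_eg -sm_Xg subrK.
- rewrite expr2; set h := 2%:R^-1.
  have ggX : g * X * (g * X) = g * (g * (X * X)).
    by rewrite -!mulrA (mulrA X) sm_Xg -!mulrA.
  have -> : e * g * (g * X) = g * (g * (X * e)) + h *: (g * (g * (X * X)))
      - g * (g * (X * X)) - g * (g * (X * X)).
    rewrite {1}sm_eg mulrBl ggX; congr (_ - _).
    rewrite -mulrA (mulrA e) sm_eg mulrBl mulrBr -!mulrA heX !mulrDr.
    by rewrite -!scalerAr expr2.
  have -> : g * X * (e * g) = g * (g * (X * e)) - g * (g * (X * X)).
    by rewrite sm_eg mulrBr ggX; congr (_ - _); rewrite -!mulrA (mulrA X) sm_Xg -!mulrA.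
  rewrite ggX -!addrA; congr (_ + _); rewrite addrC -addrA; congr (_ + _).
  by rewrite -[X in - X + _](half2 (g * (g * (X * X)))) opprD subrK.
- by rewrite hzv subrK.
- by rewrite hzu subrK.
- by rewrite !mulrA hze mulrDl -!mulrA sm_zg.
- by rewrite mulrA sm_zg -!mulrA hzX mulrDr.
- exact: sm_vg.
- exact: sm_ug.
- rewrite mulrA sm_vg mulrDl -!mulrA hvX huX mulrDr mulrBr hgt mulr1.
  by rewrite -!addrA.
- by rewrite mulrA sm_ug -!mulrA huX.
- rewrite mulrA -[u * e](addrK (1 - t)) -heu mulrBl -!mulrA sm_ug.
  by rewrite mulrBl mul1r htg opprB.
- rewrite mulrA -[v * e](addrK zeta) -hev mulrBl -!mulrA sm_vg mulrDr sm_zg.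
  by rewrite addrAC.
- exact: sm_zg.
Qed.

End Inverse.

Lemma double_smash u v zeta g t x y : double_hold u v zeta g t x y ->
  smash_rel g t (t * x) u (y * t) v zeta.
Proof.
move=> D; have R l r : (l, r) \in double_relations u v zeta g t x y -> l = r.
  exact: D.
have hgt : g * t = 1 by apply: R; rewrite !inE eqxx ?orbT.
have htg : t * g = 1 by apply: R; rewrite !inE eqxx ?orbT.
have hgx : g * x = x * g by apply: R; rewrite !inE eqxx ?orbT.
have hgy : g * y = y * g + x * g by apply: R; rewrite !inE eqxx ?orbT.
have hyx : y * x = x * y - 2%:R^-1 *: x ^+ 2 by apply: R; rewrite !inE eqxx ?orbT.
have hvz : v * zeta = zeta * v + v by apply: R; rewrite !inE eqxx ?orbT.
have huz : u * zeta = zeta * u + u by apply: R; rewrite !inE eqxx ?orbT.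
have hvu : v * u = u * v - 2%:R^-1 *: u ^+ 2 by apply: R; rewrite !inE eqxx ?orbT.
have hzy : zeta * y = y * zeta + y by apply: R; rewrite !inE eqxx ?orbT.
have hzx : zeta * x = x * zeta + x by apply: R; rewrite !inE eqxx ?orbT.
have hvg : v * g = g * v + g * u by apply: R; rewrite !inE eqxx ?orbT.
have hug : u * g = g * u by apply: R; rewrite !inE eqxx ?orbT.
have hvx : v * x = x * v + (1 - g) + x * u by apply: R; rewrite !inE eqxx ?orbT.
have hux : u * x = x * u by apply: R; rewrite !inE eqxx ?orbT.
have huy : u * y = y * u + (1 - g) by apply: R; rewrite !inE eqxx ?orbT.
have hvy : v * y = y * v - g * zeta + y * u by apply: R; rewrite !inE eqxx ?orbT.
have hzg : zeta * g = g * zeta by apply: R; rewrite !inE eqxx ?orbT.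
have tK a : t * (g * a) = a by rewrite mulrA htg mul1r.
have Kt a : a * g * t = a by rewrite -mulrA hgt mulr1.
have inv a b : g * a = a * g + b * g -> a * t = t * a + t * b.
  move=> h; have : t * (g * a) * t = t * (a * g + b * g) * t by rewrite h.
  by rewrite tK mulrDr mulrDl !mulrA !Kt.
have comm a : a * g = g * a -> a * t = t * a.
  by move=> h; rewrite (@inv _ 0) ?mulr0 ?mul0r addr0.
have xt : x * t = t * x by apply: comm.
have ut := comm _ hug; have zt := comm _ hzg.
have yt : y * t = t * y + t * x by apply: inv.
have vt : v * t = t * v - t * u.
  by rewrite -mulrN; apply: inv; rewrite hvg mulNr hug addrK.
have ttx : t * x * (t * x) = t * (t * (x * x)).
  by rewrite -!mulrA (mulrA x) xt -!mulrA.
split=> //.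
- by rewrite -mulrA xt.
- by rewrite mulrA ut -!mulrA hux.
- by rewrite {1}yt mulrDl -!mulrA xt.
- rewrite expr2; set h := 2%:R^-1.
  have -> : y * t * (t * x) = t * (t * (x * y)) - h *: (t * (t * (x * x)))
      + t * (t * (x * x)) + t * (t * (x * x)).
    rewrite {1}yt mulrDl ttx; congr (_ + _).
    rewrite -mulrA (mulrA y) yt mulrDl mulrDr -!mulrA hyx mulrBr expr2.
    by rewrite mulrBr -!scalerAr.
  have -> : t * x * (y * t) = t * (t * (x * y)) + t * (t * (x * x)).
    by rewrite yt mulrDr ttx; congr (_ + _); rewrite -!mulrA (mulrA x) xt -!mulrA.
  rewrite ttx -!addrA; congr (_ + _); rewrite addrCA; congr (_ + _).
  by rewrite -[X in _ + X](half2 (t * (t * (x * x)))) addKr.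
- rewrite -mulrA -ut !mulrA huy mulrDl mulrBl mul1r hgt -addrA.
  by rewrite -[1 - t]opprB subrr addr0.
- by rewrite mulrA zt -!mulrA hzx mulrDr.
- by rewrite huz addrK.
- rewrite mulrA vt mulrBl -!mulrA hvx !mulrDr mulrN htg mulr1 hux.
  by rewrite addrK.
- by rewrite mulrA hzy mulrDl -!mulrA zt.
- by rewrite hvz addrK.
- rewrite [v * _]mulrA hvy !mulrDl mulNr -!mulrA vt ut zt mulrBr.
  by rewrite (mulrA g) hgt mul1r (addrAC _ _ (y * (t * u))) !subrK.
Qed.

End SmashRelations.

(** * A representation by differential operators *)

Record is_derivation (R : comNzRingType) (d : R -> R) : Prop := IsDerivation {
  der_add : forall a b, d (a + b) = d a + d b;
  der_mul : forall a b, d (a * b) = d a * b + a * d b }.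

Section DifferentialOperators.
Variables (k : fieldType) (R : comAlgType k).
Variables (x u e v z : R) (dx du de dv : R -> R).
Hypothesis two_neq0 : 2%:R != 0 :> k.
Hypotheses (derx : is_derivation dx) (deru : is_derivation du)
  (dere : is_derivation de) (derv : is_derivation dv).
Hypotheses (dxZ : scalable dx) (duZ : scalable du)
  (deZ : scalable de) (dvZ : scalable dv).
Hypotheses (dux : forall a, du (dx a) = dx (du a))
  (dex : forall a, de (dx a) = dx (de a))
  (dvx : forall a, dv (dx a) = dx (dv a))
  (deu : forall a, de (du a) = du (de a))
  (dvu : forall a, dv (du a) = du (dv a))
  (dve : forall a, dv (de a) = de (dv a)).
Hypotheses (dx_x : dx x = 1) (du_x : du x = 0) (de_x : de x = 0) (dv_x : dv x = 0)
  (dx_u : dx u = 0) (du_u : du u = 1) (de_u : de u = 0) (dv_u : dv u = 0)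
  (dx_e : dx e = 0) (du_e : du e = 0) (de_e : de e = 1) (dv_e : dv e = 0)
  (dx_v : dx v = 0) (du_v : du v = 0) (de_v : de v = 0) (dv_v : dv v = 1)
  (dx_z : dx z = 0) (du_z : du z = 0) (de_z : de z = 0) (dv_z : dv z = 0).

Let V := int -> R.
Let h : R := (2%:R^-1)%:A.

Let hE : 2 * h = 1.
Proof. by rewrite /h mulr_natl -scaler_nat scalerA divff // scale1r. Qed.

Section OneDerivation.
Variable d : R -> R.
Hypotheses (der : is_derivation d) (dZ : scalable d).
Lemma der0 : d 0 = 0.
Proof. by apply: (addrI (d 0)); rewrite -(der_add der) !addr0. Qed.
Lemma derN a : d (- a) = - d a.
Proof. by apply: (addrI (d a)); rewrite -(der_add der) !subrr der0. Qed.
Lemma der1 : d 1 = 0.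
Proof.
by apply: (addrI (d 1)); rewrite -{1}[in RHS](mul1r 1) (der_mul der) mulr1 mul1r addr0.
Qed.
Lemma der_scalar c : d c%:A = 0. Proof. by rewrite dZ der1 scaler0. Qed.
Lemma der_nat n : d n%:R = 0.
Proof. by elim: n => [|n IHn]; rewrite ?der0 // -natr1 (der_add der) IHn der1 addr0. Qed.
Lemma der_int n : d n%:~R = 0.
Proof. by case: n => n; rewrite ?NegzE ?mulrNz ?derN; rewrite -?pmulrn der_nat ?oppr0. Qed.
Lemma der_exp0 b n : d b = 0 -> d (b ^+ n) = 0.
Proof.
move=> db; elim: n => [|n IHn]; first by rewrite expr0 der1.
by rewrite exprS (der_mul der) db IHn mul0r mulr0 addr0.
Qed.
Lemma der_mul0 a b : d a = 0 -> d b = 0 -> d (a * b) = 0.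
Proof. by move=> da db; rewrite (der_mul der) da db mul0r mulr0 addr0. Qed.
End OneDerivation.

(** A formal series [f : V] stands for the sum of the [f n T^n], so that [t] acts
    by a shift and [T d/dT] multiplies [f n] by [n].  The operator of a letter of
    sl2 is left multiplication on [U(sl2)] in the PBW order [e], [v], [zeta] plus
    its derivation of the Laurent polynomials; for instance [v] acts on
    [U(sl2)] by [v - z d/de + v d/dv d/de - 1/2 e (d/de)^2]. *)
Definition op_T (f : V) : V := fun n => f (n - 1).
Definition op_G (f : V) : V := fun n => f (n + 1).
Definition op_X (f : V) : V := fun n => x * f n.
Definition op_U (f : V) : V := fun n => u * f n.
Definition op_E (f : V) : V := fun n =>
  e * f n + h * (x * (x * dx (f n))) + n%:~R * (x * f n)
  + du (f n) - du (f (n - 1)).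
Definition op_Z (f : V) : V := fun n =>
  z * f n + e * de (f n) - v * dv (f n) + x * dx (f n) - u * du (f n).
Definition op_V (f : V) : V := fun n =>
  v * f n - z * de (f n) + v * dv (de (f n)) - h * (e * de (de (f n)))
  + dx (f (n - 1)) - dx (f n) - n%:~R * (u * f n) - h * (u * (u * du (f n))).

Let derE := (der_add derx, der_add deru, der_add dere, der_add derv,
  derN derx, derN deru, derN dere, derN derv,
  der_mul derx, der_mul deru, der_mul dere, der_mul derv,
  der_int derx, der_int deru, der_int dere, der_int derv,
  der_scalar derx dxZ, der_scalar deru duZ, der_scalar dere deZ,
  der_scalar derv dvZ, der0 derx, der0 deru, der0 dere, der0 derv,
  der1 derx, der1 deru, der1 dere, der1 derv,
  (dux, dex, dvx, deu, dvu, dve),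
  (dx_x, du_x, de_x, dv_x, dx_u, du_u, de_u, dv_u),
  (dx_e, du_e, de_e, dv_e, dx_v, du_v, de_v, dv_v, dx_z, du_z, de_z, dv_z)).

Fact op_T_linear : linear op_T. Proof. by move=> c f g; apply/funext. Qed.
Fact op_G_linear : linear op_G. Proof. by move=> c f g; apply/funext. Qed.
Let fE (c : k) (f g : V) n : (c *: f + g) n = c%:A * f n + g n.
Proof. by rewrite mulr_algl. Qed.

Let linear_opP (op : V -> V) :
  (forall c f g n, op (c *: f + g) n = c%:A * op f n + op g n) -> linear op.
Proof. by move=> opP c f g; apply/funext => n; rewrite opP mulr_algl. Qed.

Ltac linear_op := apply: linear_opP => c f g n;
  rewrite /op_E /op_Z /op_V /op_X /op_U ?fE ?derE; ring.
Fact op_X_linear : linear op_X. Proof. linear_op. Qed.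
Fact op_U_linear : linear op_U. Proof. linear_op. Qed.
Fact op_E_linear : linear op_E. Proof. linear_op. Qed.
Fact op_Z_linear : linear op_Z. Proof. linear_op. Qed.
Fact op_V_linear : linear op_V. Proof. linear_op. Qed.

Definition vac : V := fun n => if n == 0 then 1 else 0.

Fact vac_neq0 : vac != 0.
Proof.
by apply/eqP => /(congr1 (fun f : V => f 0)) /eqP; rewrite /vac eqxx oner_eq0.
Qed.

Local Notation L := (lend vac_neq0).
Let lT : L := Lend _ op_T_linear.
Let lG : L := Lend _ op_G_linear.
Let lX : L := Lend _ op_X_linear.
Let lU : L := Lend _ op_U_linear.
Let lE : L := Lend _ op_E_linear.
Let lZ : L := Lend _ op_Z_linear.
Let lV : L := Lend _ op_V_linear.

Let lendE := (@lendDE k V vac vac_neq0, @lendME k V vac vac_neq0,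
  @lendNE k V vac vac_neq0, @lendZE k V vac vac_neq0, @lend1E k V vac vac_neq0).
Let addE (f g : V) n : (f + g) n = f n + g n. Proof. by []. Qed.
Let oppE (f : V) n : (- f) n = - f n. Proof. by []. Qed.
Let scaleE c (f : V) n : (c *: f) n = c%:A * f n.
Proof. by rewrite mulr_algl. Qed.

Ltac op_expand f n := apply: lendP => f; apply/funext => n;
  rewrite ?expr2 !lendE ?addE ?oppE ?addE ?oppE ?scaleE /=;
  rewrite /op_T /op_G /op_X /op_U /op_E /op_Z /op_V -?/h ?(subrK, addrK) ?derE.

Lemma op_smash : smash_rel lG lT lX lU lE lV lZ.
Proof.
split; op_expand f n; [ring..|].
(* Only [e v - v e = zeta] depends on the value of h = 1/2; the defect is a
   multiple of 2 h - 1. *)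
apply/eqP; rewrite -subr_eq0; apply/eqP.
transitivity ((2 * h - 1) * (e * de (f n) + x * dx (f n) - x * dx (f (n - 1))
  - u * du (f n) + u * du (f (n - 1)))); first ring.
by rewrite hE subrr mul0r.
Qed.


Definition single (i : int) (q : R) : V := fun n => if n == i then q else 0.

Lemma op_T_single i q : op_T (single i q) = single (i + 1) q.
Proof. by apply/funext => n; rewrite /op_T /single subr_eq. Qed.

Lemma op_X_single i q : op_X (single i q) = single i (x * q).
Proof. by apply/funext => n; rewrite /op_X /single; case: eqP; rewrite ?mulr0. Qed.

Lemma op_U_single i q : op_U (single i q) = single i (u * q).
Proof. by apply/funext => n; rewrite /op_U /single; case: eqP; rewrite ?mulr0. Qed.

Lemma op_E_single q : dx q = 0 -> du q = 0 ->
  op_E (single 0 q) = single 0 (e * q).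
Proof.
move=> qx qu; apply/funext => n; rewrite /op_E /single.
by have [->|_] := eqVneq n 0; case: eqP => _; rewrite ?derE ?qx ?qu; ring.
Qed.

Lemma op_Z_single q : dx q = 0 -> du q = 0 -> de q = 0 -> dv q = 0 ->
  op_Z (single 0 q) = single 0 (z * q).
Proof.
move=> qx qu qe qv; apply/funext => n; rewrite /op_Z /single.
by case: eqP => _; rewrite ?derE ?qx ?qu ?qe ?qv; ring.
Qed.

Lemma op_V_single q : dx q = 0 -> du q = 0 -> de q = 0 ->
  op_V (single 0 q) = single 0 (v * q).
Proof.
move=> qx qu qe; apply/funext => n; rewrite /op_V /single.
have qev : de (dv q) = 0 by rewrite -dve qe derE.
by have [->|_] := eqVneq n 0; case: eqP => _;
  rewrite ?derE ?qx ?qu ?qe ?qev ?derE; ring.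
Qed.

(** Applied from the right, each letter meets a monomial in the variables to its
    right only, which its derivations kill, so it just multiplies. *)
Lemma monomial_vac i a c j l m :
  (lT ^+ i * (lX ^+ a * (lU ^+ c * (lE ^+ j * (lV ^+ l * lZ ^+ m))))) vac =
  single i (x ^+ a * (u ^+ c * (e ^+ j * (v ^+ l * z ^+ m)))).
Proof.
rewrite !lendME !lendXE.
have -> : iter m lZ vac = single 0 (z ^+ m).
  elim: m => [|m /= ->]; first exact/funext.
  by rewrite op_Z_single ?exprS //; apply: der_exp0.
have -> : iter l lV (single 0 (z ^+ m)) = single 0 (v ^+ l * z ^+ m).
  elim: l => [|l /= ->]; first by rewrite mul1r.
  rewrite op_V_single ?exprS ?mulrA //; apply: der_mul0 => //;
  exact: der_exp0.
have -> : iter j lE (single 0 (v ^+ l * z ^+ m)) =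
    single 0 (e ^+ j * (v ^+ l * z ^+ m)).
  elim: j => [|j /= ->]; first by rewrite mul1r.
  rewrite op_E_single ?exprS ?mulrA //;
  by do 2?[apply: der_mul0 => //]; apply: der_exp0.
set q := e ^+ j * _.
have -> : iter c lU (single 0 q) = single 0 (u ^+ c * q).
  elim: c => [|c /= ->]; first by rewrite mul1r.
  by rewrite op_U_single exprS mulrA.
have -> : iter a lX (single 0 (u ^+ c * q)) = single 0 (x ^+ a * (u ^+ c * q)).
  elim: a => [|a /= ->]; first by rewrite mul1r.
  by rewrite op_X_single exprS mulrA.
elim: i => [//|i /= ->].
by rewrite op_T_single intS addrC.
Qed.

Theorem smash_representation : exists g t X U E W Z : L,
  [/\ smash_rel g t X U E W Z,
      [/\ g =1 op_G, t =1 op_T, X =1 op_X & U =1 op_U],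
      [/\ E =1 op_E, W =1 op_V & Z =1 op_Z] &
      forall i a c j l m,
      (t ^+ i * (X ^+ a * (U ^+ c * (E ^+ j * (W ^+ l * Z ^+ m))))) vac =
      single i (x ^+ a * (u ^+ c * (e ^+ j * (v ^+ l * z ^+ m))))].
Proof.
exists lG, lT, lX, lU, lE, lV, lZ; split=> //; first exact: op_smash.
exact: monomial_vac.
Qed.

End DifferentialOperators.

(** ** The generators of the double *)

Lemma double_relations_map (k : fieldType) (A B : algType k)
    (f : {lrmorphism A -> B}) (u v zeta g ginv x y : A) :
  double_relations (f u) (f v) (f zeta) (f g) (f ginv) (f x) (f y) =
  [seq (f p.1, f p.2) | p <- double_relations u v zeta g ginv x y].
Proof.
have fZ (a : A) : f (2%:R^-1 *: a ^+ 2) = 2%:R^-1 *: f a ^+ 2.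
  by rewrite linearZ rmorphXn.
rewrite /double_relations /= !(rmorphB, rmorphD, rmorphM, rmorph1, fZ).
by rewrite -!fZ.
Qed.

Section DoubleGenerators.
Variable k : fieldType.
Hypothesis two_neq0 : 2%:R != 0 :> k.

Local Notation A := (double_alg k).

Definition gA : A := pgen (double_proper k) Dg.
Definition tA : A := pgen (double_proper k) Dginv.
Definition XA : A := tA * pgen (double_proper k) Dx.
Definition uA : A := pgen (double_proper k) Du.
Definition eA : A := pgen (double_proper k) Dy * tA.
Definition vA : A := pgen (double_proper k) Dv.
Definition zA : A := pgen (double_proper k) Dzeta.

Lemma smashA : smash_rel gA tA XA uA eA vA zA.
Proof.
apply: double_smash => // l r.
rewrite (double_relations_map (quot_pi (double_proper k))).
by case/mapP => -[l' r'] /= lr [-> ->]; apply: pgen_rel.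
Qed.

Lemma double_lift (B : algType k) (g t X u e v zeta : B) :
    smash_rel g t X u e v zeta ->
  exists f : {lrmorphism A -> B},
    [/\ f gA = g, f tA = t, f XA = X & f uA = u] /\
    [/\ f eA = e, f vA = v & f zA = zeta].
Proof.
move=> S; have D := smash_double two_neq0 S.
pose a i : B := match i with
  | Du => u | Dv => v | Dzeta => zeta | Dg => g | Dginv => t | Dx => g * X
  | Dy => e * g end.
have ha l r : double_rel l r -> feval a l = feval a r.
  move=> lr; apply: D.
  have := double_relations_map (feval a) (fgen k Du) (fgen k Dv) (fgen k Dzeta)
    (fgen k Dg) (fgen k Dginv) (fgen k Dx) (fgen k Dy).
  rewrite /= !feval_fgen /= => ->.
  by apply: (map_f (fun p => (feval a p.1, feval a p.2)) lr).
have [f fa] := presentation_lift (double_proper k) ha.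
have fX : f XA = f tA * f (pgen _ Dx) := rmorphM _ _ _.
have fe : f eA = f (pgen _ Dy) * f tA := rmorphM _ _ _.
have ft : f tA = t := fa Dginv.
exists f; split; split; [exact: (fa Dg)|exact: ft| |exact: (fa Du)| |
  exact: (fa Dv)|exact: (fa Dzeta)].
  by rewrite fX ft fa mulrA (sm_tg S) mul1r.
by rewrite fe ft fa -mulrA (sm_gt S) mulr1.
Qed.

Lemma doubleA_generated :
  generated_by (fun a => a \in [:: gA; tA; XA; uA; eA; vA; zA]).
Proof.
move=> P P1 PD PM PZ Pgen.
have L i : (i < 7)%N -> P (nth 1 [:: gA; tA; XA; uA; eA; vA; zA] i).
  by move=> i7; apply: Pgen; apply: mem_nth.
have Pg : P gA := L 0%N isT. have Pt : P tA := L 1%N isT.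
have PX : P XA := L 2%N isT. have Pu : P uA := L 3%N isT.
have Pe : P eA := L 4%N isT. have Pv : P vA := L 5%N isT.
have Pz : P zA := L 6%N isT.
have hgt := sm_gt smashA; have htg := sm_tg smashA.
have Px : P (gA * XA) by apply: PM.
have Py : P (eA * gA) by apply: PM.
rewrite /XA mulrA hgt mul1r in Px; rewrite /eA -mulrA htg mulr1 in Py.
by apply: (presentation_ind P1 PD PM PZ); case.
Qed.

End DoubleGenerators.

(** * The filtration by words *)

Section WordFiltration.
Variables (k : fieldType) (A : algType k) (g t X u e v z : A).
Hypothesis S : smash_rel g t X u e v z.
Hypothesis A_gen : generated_by (fun a => a \in [:: g; t; X; u; e; v; z]).

(** Words are coded by the positions of their letters in [letters]; a position
    out of range stands for 1.  The last three letters, those of sl2, have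
    weight 1. *)
Definition letters : seq A := [:: g; t; X; u; e; v; z].
Definition letter (i : nat) : A := nth 1 letters i.
Definition letter_weight (i : nat) : nat := (3 < i < 7)%N.
Definition word (w : seq nat) : A := \prod_(i <- w) letter i.
Definition weight (w : seq nat) : nat := \sum_(i <- w) letter_weight i.

Inductive word_fil (n : nat) : A -> Prop :=
| WordFil0 : word_fil n 0
| WordFilD c w a of (weight w <= n)%N & word_fil n a :
    word_fil n (c *: word w + a).

Lemma word_fil_word n w : (weight w <= n)%N -> word_fil n (word w).
Proof.
by move=> wn; rewrite -[word w]addr0 -[word w]scale1r; do !constructor.
Qed.

Lemma word_filD n a b : word_fil n a -> word_fil n b -> word_fil n (a + b).
Proof.
move=> Fa Fb; elim: Fa => [|c w a' wn _ IH]; first by rewrite add0r.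
by rewrite -addrA; constructor.
Qed.

Lemma word_filZ n c a : word_fil n a -> word_fil n (c *: a).
Proof.
elim=> [|d w a' wn _ IH]; first by rewrite scaler0; constructor.
by rewrite scalerDr scalerA; constructor.
Qed.

Lemma word_filS n a : word_fil n a -> word_fil n.+1 a.
Proof.
by elim=> [|d w a' wn _ IH]; constructor=> //; apply: leqW.
Qed.

Lemma word_fil1 : word_fil 0 1.
Proof.
by have := @word_fil_word 0 [::]; rewrite /word /weight !big_nil; apply.
Qed.

Lemma wordM w w' : word (w ++ w') = word w * word w'.
Proof. exact: big_cat. Qed.

Lemma weightM w w' : weight (w ++ w') = (weight w + weight w')%N.
Proof. exact: big_cat. Qed.

Lemma word_filM m n a b :
  word_fil m a -> word_fil n b -> word_fil (m + n) (a * b).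
Proof.
move=> Fa Fb; elim: Fa => [|c w a' wm _ IH].
  by rewrite mul0r; constructor.
rewrite mulrDl; apply: word_filD => //; elim: Fb {IH} => [|d w' b' wn _ IH].
  by rewrite mulr0; constructor.
rewrite mulrDr; apply: word_filD => //; rewrite -scalerAl -scalerAr.
do 2!apply: word_filZ; rewrite -wordM; apply: word_fil_word.
by rewrite weightM leq_add.
Qed.

Definition FA : filtration A := Filtration (fun=> WordFil0 _) word_filD word_filZ
  word_filS word_fil1 word_filM.

Lemma FA_letter i : FA (letter_weight i) (letter i).
Proof.
have := @word_fil_word (letter_weight i) [:: i].
by rewrite /word /weight !big_seq1; apply.
Qed.

Lemma FA_exhaustive : exhaustive FA.
Proof.
have FL i : exists n, FA n (letter i) by exists (letter_weight i); apply: FA_letter.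
have FM a b : (exists n, FA n a) -> (exists n, FA n b) -> exists n, FA n (a * b).
  by move=> [m Fa] [n Fb]; exists (m + n)%N; apply: filM.
apply: A_gen => [|a b [m Fa] [n Fb]|//|c a [m Fa]|a /(nthP 1)[i _ <-]].
- by exists 0%N; apply: fil1.
- exists (m + n)%N; apply: filD.
    exact: (chain_le (@filS _ _ FA)) (leq_addr _ _) Fa.
  exact: (chain_le (@filS _ _ FA)) (leq_addl _ _) Fb.
- by exists m; apply: filZ.
- exact: FL.
Qed.

Lemma fil_predD n a b : fil_pred FA n a -> fil_pred FA n b -> fil_pred FA n (a + b).
Proof. by case: n => [-> ->|n]; [rewrite /= addr0|apply: filD]. Qed.

Lemma fil_predN n a : fil_pred FA n a -> fil_pred FA n (- a).
Proof. by rewrite -sub0r; apply: fil_predB; apply: fil_pred0. Qed.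

Lemma fil_predZ n c a : fil_pred FA n a -> fil_pred FA n (c *: a).
Proof. by case: n => [->|n]; [rewrite /= scaler0|apply: filZ]. Qed.

Lemma fil_predMl m n a b : FA m a -> fil_pred FA n b -> fil_pred FA (m + n) (a * b).
Proof.
case: n => [|n] Fa; first by move=> ->; rewrite mulr0; apply: fil_pred0.
by rewrite addnS; apply: filM.
Qed.

Lemma fil_predMr m n a b : fil_pred FA m a -> FA n b -> fil_pred FA (m + n) (a * b).
Proof.
case: m => [|m]; first by move=> -> _; rewrite mul0r; apply: fil_pred0.
by rewrite addSn; apply: filM.
Qed.

(** The brackets are [zeta], [e] and [v] inside sl2, of weight 1 instead of 2;
    they lie in the weight 0 part between sl2 and [g], [t], [X], [u]; the latter
    commute. *)
Lemma letter_commutator i j :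
  fil_pred FA (letter_weight i + letter_weight j)
    (letter i * letter j - letter j * letter i).
Proof.
wlog: i j / (i < j)%N => [hwlog|ij].
  case: (ltngtP i j) => [|ji|->]; first exact: hwlog.
    by rewrite -opprB addnC; apply/fil_predN/hwlog.
  by rewrite subrr; apply: fil_pred0.
have [j7|j7] := leqP 7 j.
  by rewrite [letter j]nth_default // mulr1 mul1r subrr; apply: fil_pred0.
have [hgt htg hXt hut huX het heX heu hzt hzX hzu hvt hvX hvu hze hzv hev] := S.
have FL i' : FA (letter_weight i') (letter i') by apply: FA_letter.
have Fg : FA 0 g := FL 0%N. have Ft : FA 0 t := FL 1%N.
have FX : FA 0 X := FL 2%N. have Fu : FA 0 u := FL 3%N.
have F1 : FA 0 1 := fil1 FA.
have F00 a b : FA 0 a -> FA 0 b -> FA 0 (a * b) := @filM _ _ FA 0 0 a b.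
have FD a b : FA 0 a -> FA 0 b -> FA 0 (a - b).
  by move=> Fa Fb; apply: filD => //; rewrite -scaleN1r; apply: filZ.
have N0 a : FA 0 a -> FA 0 (- a) by rewrite -scaleN1r; apply: filZ.
have addKL (a b : A) : a + b - a = b by rewrite addrAC subrr add0r.
have subKL (a b : A) : a - (a + b) = - b by rewrite opprD addrA subrr add0r.
have subNL (a b : A) : a - (a - b) = b by rewrite opprB addrCA subrr addr0.
case: i ij => [|[|[|[|[|[|i]]]]]]; case: j j7 => [|[|[|[|[|[|[|j]]]]]]] // _ _;
  rewrite /letter /letter_weight /=.
- by rewrite hgt htg subrr.
- by rewrite (sm_Xg S) subrr.
- by rewrite (sm_ug S) subrr.
- by rewrite (sm_eg S) subNL; apply: F00.
- by rewrite (sm_vg S) subKL; apply/N0/F00.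
- by rewrite (sm_zg S) subrr; apply: (fil0 FA).
- by rewrite hXt subrr.
- by rewrite hut subrr.
- by rewrite het subKL; apply/N0/F00.
- by rewrite hvt subNL; apply: F00.
- by rewrite hzt subrr; apply: (fil0 FA).
- by rewrite huX subrr.
- by rewrite heX subKL; apply/N0/(filZ (f := FA)); rewrite expr2; apply: F00.
- by rewrite hvX subKL; apply/N0/FD.
- by rewrite hzX subKL; apply: N0.
- by rewrite heu subKL; apply/N0/FD.
- by rewrite hvu subNL; apply: (filZ (f := FA)); rewrite expr2; apply: F00.
- by rewrite hzu subNL.
- by rewrite hev addKL; apply: (FL 6%N).
- by rewrite hze subKL -scaleN1r; apply/(filZ (f := FA))/(FL 4%N).
- by rewrite hzv subNL; apply: (FL 5%N).
Qed.

Lemma word_cons i w : word (i :: w) = letter i * word w.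
Proof. exact: big_cons. Qed.

Lemma weight_cons i w : weight (i :: w) = (letter_weight i + weight w)%N.
Proof. exact: big_cons. Qed.

Lemma commMl (a b c : A) :
  a * b * c - c * (a * b) = a * (b * c - c * b) + (a * c - c * a) * b.
Proof. by rewrite mulrBr mulrBl !mulrA addrA subrK. Qed.

Lemma FA_commutator m n a b : FA m a -> FA n b ->
  fil_pred FA (m + n) (a * b - b * a).
Proof.
have FW w : FA (weight w) (word w) by apply: word_fil_word.
have cL i w : fil_pred FA (letter_weight i + weight w)
    (letter i * word w - word w * letter i).
  elim: w => [|j w IHw].
    by rewrite /word big_nil mulr1 mul1r subrr; apply: fil_pred0.
  rewrite word_cons weight_cons -opprB commMl; apply/fil_predN/fil_predD.
    rewrite addnCA; apply: fil_predMl; first exact: FA_letter.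
    by rewrite -opprB; apply: fil_predN.
  rewrite addnA; apply: fil_predMr => //; rewrite -opprB; apply: fil_predN.
  exact: letter_commutator.
have cW w w' : fil_pred FA (weight w + weight w')
    (word w * word w' - word w' * word w).
  elim: w => [|j w IHw].
    by rewrite /word big_nil mulr1 mul1r subrr; apply: fil_pred0.
  rewrite word_cons weight_cons commMl; apply/fil_predD.
    by rewrite -addnA; apply: fil_predMl => //; apply: FA_letter.
  by rewrite addnAC; apply: fil_predMr.
have pred_le i j c : (i <= j)%N -> fil_pred FA i c -> fil_pred FA j c.
  case: i => [|i] /=; first by move=> _ ->; apply: fil_pred0.
  by case: j => // j; rewrite ltnS => ij; apply: (chain_le (@filS _ _ FA)).
move=> Fa Fb; elim: Fa => [|c w {}a wm _ IH].
  by rewrite mul0r mulr0 subrr; apply: fil_pred0.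
rewrite mulrDl mulrDr opprD addrACA; apply: fil_predD => // {IH a}.
rewrite -scalerAl -scalerAr -scalerBr; apply: fil_predZ.
elim: Fb => [|d w' {}b wn _ IH].
  by rewrite mul0r mulr0 subrr; apply: fil_pred0.
rewrite mulrDl mulrDr opprD addrACA; apply: fil_predD => // {IH b}.
rewrite -scalerAl -scalerAr -scalerBr; apply: fil_predZ.
by apply: pred_le (cW w w'); apply: leq_add.
Qed.

(** * The associated graded algebra *)

Lemma gr_comm (a b : gr FA) : a * b = b * a.
Proof. exact: gr_commutative FA_commutator _ _. Qed.

Definition letter_symbol i : gr FA := symbol FA (letter_weight i) (letter i).

Lemma symbol_word w : symbol FA (weight w) (word w) = \prod_(i <- w) letter_symbol i.
Proof.
elim: w => [|i w IHw]; first by rewrite /weight /word !big_nil symbol1.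
rewrite big_cons -IHw word_cons weight_cons symbolM //; first exact: FA_letter.
exact: word_fil_word.
Qed.

(** A word of weight below the degree has symbol 0, and the symbol of any other
    word is the product of the symbols of its letters. *)
Lemma gr_letters_ind (P : gr FA -> Prop) :
    P 1 -> (forall a b, P a -> P b -> P (a + b)) ->
    (forall a b, P a -> P b -> P (a * b)) -> (forall c a, P a -> P (c *: a)) ->
    (forall i, (i < 7)%N -> P (letter_symbol i)) ->
  forall a, P a.
Proof.
move=> P1 PD PM PZ PL; have P0 : P 0 by rewrite -(scale0r 1); apply: PZ.
apply: gr_ind => // n a; elim=> [|c w {}a wn Fa IH].
  by rewrite symbol0.
have Fw : FA n (word w) by apply: word_fil_word.
rewrite symbolD //; last exact: filZ.
apply: PD => //; rewrite symbolZ //; apply: PZ.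
move: wn; rewrite leq_eqVlt => /orP[/eqP <-|wn].
  rewrite symbol_word; apply: big_ind => // i _.
  have [/PL //|i7] := ltnP i 7.
  rewrite /letter_symbol /letter_weight (ltnNge i) i7 andbF.
  by rewrite /letter nth_default // symbol1.
suff -> : symbol FA n (word w) = 0 by [].
apply/symbol_eq0 => //; case: n wn {Fa Fw IH} => // n wn.
exact: word_fil_word.
Qed.

End WordFiltration.

(** * The algebra k[T,T^-1] (x) k[X_1, ..., X_n] *)

Section CommutativeMonomials.
Variables (k : comNzRingType) (B : algType k).
Hypothesis BC : forall a b : B, a * b = b * a.

Lemma prodM_comm (I : Type) (r : seq I) (F G : I -> B) :
  \prod_(i <- r) (F i * G i) = \prod_(i <- r) F i * \prod_(i <- r) G i.
Proof.
elim: r => [|i r IHr]; first by rewrite !big_nil mulr1.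
rewrite !big_cons IHr -!mulrA; congr (_ * _).
by rewrite mulrA (BC (G i)) -mulrA.
Qed.

Lemma mpoly_lift n (s : 'I_n -> B) :
  exists f : {lrmorphism {mpoly k[n]} -> B}, forall i, f << ucm i >> = s i.
Proof.
pose h (m : {cmonom 'I_n}) : B := \prod_i s i ^+ m i.
have hM : mmorphism h.
  split=> [m m'|]; rewrite /h; last by rewrite big1 // => i _; rewrite cm1.
  by rewrite -prodM_comm; apply: eq_bigr => i _; rewrite cmM exprD.
pose hm : {mmorphism {cmonom 'I_n} -> B} :=
  HB.pack h (isMultiplicative.Build {cmonom 'I_n} B h hM).
pose e := mmap (in_alg B) hm.
have [eM e1] : monoid_morphism e.
  have [|h1 h2] := @commr_mmap_is_multiplicative {cmonom 'I_n} k B (in_alg B) hm.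
    by move=> *; apply: BC.
  by split.
have eZ : scalable e by move=> c p; rewrite /e mmapZ mulr_algl.
pose m1 := GRing.isZmodMorphism.Build _ _ e (raddfB e).
pose m2 := GRing.isMonoidMorphism.Build _ _ e (eM, e1).
pose m3 := GRing.isScalable.Build _ _ _ _ e eZ.
pose f : {lrmorphism {mpoly k[n]} -> B} := HB.pack e m1 m2 m3.
exists f => i; rewrite [LHS](_ : _ = e << ucm i >>) // /e mmapU /= scale1r mul1r /h.
rewrite -[RHS](mpoly.mmap1U s); apply: eq_bigr => j _.
by rewrite cmU mnm1E.
Qed.


(** The explicit value is for comparing coefficients. *)
Lemma poly_mpoly_lift n (tau : B) (s : 'I_n -> B) :
  exists f : {rmorphism {poly mpoly.mpoly n k} -> B},
    [/\ f 'X = tau, forall i, f (mpoly.mpolyX k U_(i)%MM)%:P = s i,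
        forall c, f (c%:A)%:P = c%:A &
        forall p, f p = \sum_(i < size p) \sum_(m <- mpoly.msupp p`_i)
          mpoly.mcoeff m p`_i *: (tau ^+ i * mpoly.mmap1 s m)].
Proof.
pose f0 := mpoly.mmap (in_alg B) s.
have [f0M f01] : monoid_morphism f0.
  have [||f0M f01] := @mpoly.commr_mmap_is_multiplicative n k B s (in_alg B);
    try by move=> *; apply: BC.
  by split.
pose m1 := GRing.isZmodMorphism.Build _ _ f0 (raddfB f0).
pose m2 := GRing.isMonoidMorphism.Build _ _ f0 (f0M, f01).
pose f0r : {rmorphism mpoly.mpoly n k -> B} := HB.pack f0 m1 m2.
have c0 : commr_rmorph f0r tau by move=> p; apply: BC.
exists (horner_morph c0); split=> [|i|c|p].
- exact: horner_morphX.
- by rewrite [LHS](horner_morphC c0) /= /f0 mpoly.mmapX mpoly.mmap1U.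
- rewrite [LHS](horner_morphC c0) /= /f0 mpoly.mmapZ -[RHS]mulr1;
  by congr (_ * _); rewrite -mpoly.mpolyC1 mpoly.mmapC; apply: scale1r.
rewrite [LHS](_ : _ = (map_poly f0r p).[tau]) //.
rewrite (@horner_coef_wide _ (size p)) ?size_poly //.
apply: eq_bigr => i _; rewrite coef_map /= BC /f0 /mpoly.mmap mulr_sumr.
by apply: eq_bigr => m _; rewrite mulr_algl scalerAr.
Qed.

End CommutativeMonomials.

Lemma mpoly_ind (k : comNzRingType) n (P : {mpoly k[n]} -> Prop) :
    P 1 -> (forall p q, P p -> P q -> P (p + q)) ->
    (forall p q, P p -> P q -> P (p * q)) ->
    (forall c p, P p -> P (c *: p)) -> (forall i, P << ucm i >>) ->
  forall p, P p.
Proof.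
move=> P1 PD PM PZ PX p.
have P0 : P 0 by rewrite -(scale0r 1); apply: PZ.
have Pm (m : {cmonom 'I_n}) : P << m >>.
  move: {2}(mdeg m) (leqnn (mdeg m)) => d; elim: d m => [|d IHd] m.
    by rewrite leqn0 mdeg_eq0 => /eqP ->.
  have [->|m1] := eqVneq m mone; first by [].
  have [i mi] : exists i, m i != 0%N.
    apply: contrapT => m0; case/eqP: m1; apply/eqP/cmP => i; rewrite cm1.
    by apply/eqP/negPn/negP => mi; apply: m0; exists i.
  have mE : m = mmul (ucm i) (divcm m (ucm i)).
    apply/eqP/cmP => j; rewrite cmM divcmE cmU.
    by case: eqP => [<-|_]; rewrite ?subnKC ?subn0 // lt0n.
  rewrite mE mdegM mdegU add1n ltnS => /IHd Pm.
  have -> : << mmul (ucm i) (divcm m (ucm i)) >> =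
      << ucm i >> * << divcm m (ucm i) >> :> {mpoly k[n]}.
    by rewrite malgM_def fgmulUU mulr1.
  exact: PM (PX i) Pm.
rewrite [p]monalgE; apply: (big_ind P P0 PD) => m _.
by rewrite malgUZ; apply: PZ (Pm m).
Qed.

Section LaurentMpoly.
Variables (k : fieldType) (n : nat).

Local Notation Lam := (laurent_mpoly k n).
Local Notation S := (laurent k).

Definition tens (a : S) (b : {mpoly k[n]}) : Lam :=
  pgen (laurent_mpoly_proper k n) (a, b).
Definition laurT : S := pgen (laurent_proper k) true.
Definition laurTinv : S := pgen (laurent_proper k) false.

Let tens_rel l r : tensor_rel l r ->
  quot_pi (laurent_mpoly_proper k n) l = quot_pi (laurent_mpoly_proper k n) r.
Proof. exact: pgen_rel. Qed.

Lemma tensDl a a' b : tens (a + a') b = tens a b + tens a' b.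
Proof. by rewrite -raddfD; apply/tens_rel/TensorDl. Qed.
Lemma tensDr a b b' : tens a (b + b') = tens a b + tens a b'.
Proof. by rewrite -raddfD; apply/tens_rel/TensorDr. Qed.
Lemma tensZl c a b : tens (c *: a) b = c *: tens a b.
Proof. by rewrite -linearZ; apply/tens_rel/TensorZl. Qed.
Lemma tensZr c a b : tens a (c *: b) = c *: tens a b.
Proof. by rewrite -linearZ; apply/tens_rel/TensorZr. Qed.
Lemma tensM a a' b b' : tens a b * tens a' b' = tens (a * a') (b * b').
Proof. by rewrite -rmorphM; apply/tens_rel/TensorM. Qed.
Lemma tens1 : tens 1 1 = 1.
Proof. by rewrite -[RHS](rmorph1 (quot_pi _)); apply/tens_rel/Tensor1. Qed.

Lemma laurTK : laurT * laurTinv = 1.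
Proof.
rewrite -[LHS]rmorphM -[RHS](rmorph1 (quot_pi _)).
by apply: (pgen_rel (laurent_proper k)); apply: mem_head.
Qed.

Lemma laurTKV : laurTinv * laurT = 1.
Proof.
rewrite -[LHS]rmorphM -[RHS](rmorph1 (quot_pi _)).
apply: (pgen_rel (laurent_proper k)).
by rewrite /laurent_rel /laurent_relations in_cons mem_head orbT.
Qed.

Lemma laurent_ind (P : S -> Prop) :
    P 1 -> (forall a b, P a -> P b -> P (a + b)) ->
    (forall a b, P a -> P b -> P (a * b)) -> (forall c a, P a -> P (c *: a)) ->
    P laurT -> P laurTinv ->
  forall a, P a.
Proof.
by move=> P1 PD PM PZ PT PTi; apply: (presentation_ind P1 PD PM PZ); case.
Qed.

Lemma laurent_comm (a b : S) : a * b = b * a.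
Proof.
apply: presentation_comm => -[] [].
- exact (erefl _).
- exact (etrans laurTK (esym laurTKV)).
- exact (etrans laurTKV (esym laurTK)).
- exact (erefl _).
Qed.

Definition lamT : Lam := tens laurT 1.
Definition lamTinv : Lam := tens laurTinv 1.
Definition lamX (i : 'I_n) : Lam := tens 1 << ucm i >>.

Lemma lamTK : lamT * lamTinv = 1.
Proof. by rewrite tensM laurTK mulr1 tens1. Qed.

Lemma lamTKV : lamTinv * lamT = 1.
Proof. by rewrite tensM laurTKV mulr1 tens1. Qed.

Lemma laurent_mpoly_ind (P : Lam -> Prop) :
    P 1 -> (forall a b, P a -> P b -> P (a + b)) ->
    (forall a b, P a -> P b -> P (a * b)) -> (forall c a, P a -> P (c *: a)) ->
    P lamT -> P lamTinv -> (forall i, P (lamX i)) ->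
  forall a, P a.
Proof.
move=> P1 PD PM PZ PT PTi PX; apply: (presentation_ind P1 PD PM PZ) => -[a b].
have -> : pgen (laurent_mpoly_proper k n) (a, b) = tens a 1 * tens 1 b.
  by rewrite tensM mulr1 mul1r.
apply: (PM).
  elim/laurent_ind: a => [|a a' Pa Pa'|a a' Pa Pa'|c a Pa||].
  - by rewrite tens1.
  - by rewrite tensDl; exact (PD _ _ Pa Pa').
  - by rewrite -[1]mulr1 -tensM; exact (PM _ _ Pa Pa').
  - by rewrite tensZl; exact (PZ c _ Pa).
  - exact PT.
  - exact PTi.
elim/mpoly_ind: b => [|b b' Pb Pb'|b b' Pb Pb'|c b Pb|i].
- by rewrite tens1.
- by rewrite tensDr; exact (PD _ _ Pb Pb').
- by rewrite -[1]mulr1 -tensM; exact (PM _ _ Pb Pb').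
- by rewrite tensZr; exact (PZ c _ Pb).
- exact (PX i).
Qed.

Lemma laurent_mpoly_comm (a b : Lam) : a * b = b * a.
Proof.
apply: presentation_comm => -[a1 a2] [b1 b2].
rewrite -/(tens a1 a2) -/(tens b1 b2).
by apply: (etrans (tensM _ _ _ _)); rewrite laurent_comm [a2 * _]mulrC -tensM.
Qed.

Lemma laurent_mpoly_lift (B : algType k) (tau taui : B) (s : 'I_n -> B) :
    (forall a b : B, a * b = b * a) -> tau * taui = 1 ->
  exists f : {lrmorphism Lam -> B},
    [/\ f lamT = tau, f lamTinv = taui & forall i, f (lamX i) = s i].
Proof.
move=> BC tauK.
have [fS fSE] : exists f : {lrmorphism S -> B},
    forall i, f (pgen _ i) = if i then tau else taui.
  apply: presentation_lift => l r; rewrite /laurent_rel !inE.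
  by case/orP => /eqP[-> ->]; rewrite rmorphM rmorph1 /= !feval_fgen // BC.
have [fX fXE] := mpoly_lift BC s.
pose a (ab : S * {mpoly k[n]}) := fS ab.1 * fX ab.2.
have [f fE] : exists f : {lrmorphism Lam -> B}, forall ab, f (pgen _ ab) = a ab.
  apply: presentation_lift => l r []; rewrite /a.
  - by move=> b b' c; rewrite rmorphD /= !feval_fgen rmorphD mulrDl.
  - by move=> b c c'; rewrite rmorphD /= !feval_fgen rmorphD mulrDr.
  - by move=> d b c; rewrite linearZ /= !feval_fgen linearZ scalerAl.
  - by move=> d b c; rewrite linearZ /= !feval_fgen linearZ scalerAr.
  - move=> b b' c c'; rewrite rmorphM /= !feval_fgen !rmorphM /= -!mulrA.
    by congr (_ * _); rewrite mulrA (BC (fX c)) -mulrA.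
  - by rewrite rmorph1 feval_fgen !rmorph1 mulr1.
have fS1 : fS 1 = 1 := rmorph1 fS.
have fX1 : fX 1 = 1 := rmorph1 fX.
exists f; split=> [||i].
- apply: (etrans (fE (laurT, 1))); rewrite /a [fX _]fX1 mulr1.
  exact (fSE true).
- apply: (etrans (fE (laurTinv, 1))); rewrite /a [fX _]fX1 mulr1.
  exact (fSE false).
- apply: (etrans (fE (1, << ucm i >>))); rewrite /a [fS _]fS1 mul1r.
  exact (fXE i).
Qed.

End LaurentMpoly.

(** * Independence of the ordered monomials *)

Definition o5 (i : nat) : 'I_5 := inord i.

Lemma o5_inj i j : (i < 5)%N -> (j < 5)%N -> (o5 i == o5 j) = (i == j).
Proof. by move=> i5 j5; rewrite -val_eqE /= !inordK. Qed.

Lemma prod5 (B : pzRingType) (F : 'I_5 -> B) : \prod_i F i =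
  F (o5 0) * (F (o5 1) * (F (o5 2) * (F (o5 3) * F (o5 4)))).
Proof.
rewrite !big_ord_recl big_ord0 mulr1.
by do !congr (_ * _); congr F; apply: val_inj; rewrite /= inordK.
Qed.

Section PolynomialRepresentation.
Variable k : fieldType.
Local Notation R := (mpoly.mpoly 5 k).
Local Notation var i := (mpoly.mpolyX k U_(o5 i)%MM : R).
Local Notation der i := (mpoly.mderiv (o5 i) : R -> R).
Local Notation V := (int -> R).

Lemma der_var i j : (i < 5)%N -> (j < 5)%N -> der i (var j) = (j == i)%:R.
Proof.
move=> i5 j5; rewrite mpoly.mderivX mnm1E o5_inj //.
case: eqP => [->|_]; last by rewrite scale0r.
by rewrite scale1r -[X in (X - _)%MM]add0m addmK mpoly.mpolyX0.
Qed.

Definition rep_E := op_E (var 0) (var 2) (der 0) (der 1).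
Definition rep_Z := op_Z (var 0) (var 1) (var 2) (var 3) (var 4)
  (der 0) (der 1) (der 2) (der 3).
Definition rep_V := op_V (var 1) (var 2) (var 3) (var 4)
  (der 0) (der 1) (der 2) (der 3).

Lemma polynomial_representation : 2%:R != 0 :> k ->
  exists g t X U E W Z : lend (vac_neq0 R),
  [/\ smash_rel g t X U E W Z,
      [/\ g =1 @op_G k R, t =1 @op_T k R, X =1 op_X (var 0) & U =1 op_U (var 1)],
      [/\ E =1 rep_E, W =1 rep_V & Z =1 rep_Z] &
      forall (i : nat) (m : mpoly.multinom 5),
      (t ^+ i * (X ^+ m (o5 0) * (U ^+ m (o5 1) * (E ^+ m (o5 2) *
         (W ^+ m (o5 3) * Z ^+ m (o5 4)))))) (vac R) =
      single i (mpoly.mpolyX k m)].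
Proof.
move=> two_neq0.
have dP i : is_derivation (der i).
  by split=> a b; [apply: mpoly.mderivD|apply: mpoly.mderivM].
have dZ i : scalable (der i) by move=> c a; apply: mpoly.mderivZ.
have dC i j a : der i (der j a) = der j (der i a) by apply: mpoly.mderiv_comm.
have [] := @smash_representation k R (var 0) (var 1) (var 2) (var 3) (var 4)
  (der 0) (der 1) (der 2) (der 3) two_neq0; rewrite ?der_var //.
move=> g [t [X [U [E [W [Z [S h1 h2 h3]]]]]]].
exists g, t, X, U, E, W, Z; split=> // i m; rewrite h3.
by rewrite [in RHS]mpoly.mpolyXE_id prod5.
Qed.

(** ** The weight filtration of the representation *)

(** The variables are those of [X], [u], [e], [v], [zeta] in this order, and only
    the last three count. *)
Definition wt (m : mpoly.multinom 5) : nat :=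
  (m (o5 2) + m (o5 3) + m (o5 4))%N.
Definition wt_le n (p : R) := forall m, mpoly.mcoeff m p != 0 -> (wt m <= n)%N.

Lemma wt_le0 n : wt_le n 0.
Proof. by move=> m; rewrite mpoly.mcoeff0 eqxx. Qed.

Lemma wt_leD n p q : wt_le n p -> wt_le n q -> wt_le n (p + q).
Proof.
move=> hp hq m; rewrite mpoly.mcoeffD; case: (eqVneq (mpoly.mcoeff m p) 0).
  by move=> ->; rewrite add0r; apply: hq.
by move=> /hp.
Qed.

Lemma wt_leZ n c p : wt_le n p -> wt_le n (c *: p).
Proof.
move=> hp m; rewrite mpoly.mcoeffZ => h; apply: hp.
by apply: contraNneq h => ->; rewrite mulr0.
Qed.

Lemma wt_leN n p : wt_le n p -> wt_le n (- p).
Proof. by rewrite -scaleN1r; apply: wt_leZ. Qed.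

Lemma wt_leW n n' p : (n <= n')%N -> wt_le n p -> wt_le n' p.
Proof. by move=> nn' hp m /hp h; apply: leq_trans nn'. Qed.

Lemma wt_leM n n' p q : wt_le n p -> wt_le n' q -> wt_le (n + n') (p * q).
Proof.
move=> hp hq m; rewrite -mpoly.mcoeff_msupp => /mpoly.msuppM_le.
case/allpairsP => -[m1 m2] /= [h1 h2 ->].
rewrite mpoly.mcoeff_msupp in h1; rewrite mpoly.mcoeff_msupp in h2.
have := leq_add (hp _ h1) (hq _ h2); rewrite /wt !mnmDE; apply: leq_trans.
by rewrite -!addnA; lia.
Qed.

Lemma wt_le_var i : (i < 5)%N -> wt_le (1 < i)%N (var i).
Proof.
move=> i5 m; rewrite mpoly.mcoeffX.
case: (U_(o5 i)%MM =P m) => [<- _|]; last by rewrite eqxx.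
by rewrite /wt !mnm1E !o5_inj //; case: i i5 => [|[|[|[|[|]]]]].
Qed.

Lemma wt_le_der n i p : wt_le n p -> wt_le n (der i p).
Proof.
move=> hp m; rewrite mpoly.mcoeff_mderiv => h.
have : (wt (m + U_(o5 i))%MM <= n)%N.
  by apply: hp; apply: contraNneq h => ->; rewrite mul0rn.
by apply: leq_trans; rewrite /wt !mnmDE; lia.
Qed.

Lemma wt_le_scalar c : wt_le 0 (c%:A : R).
Proof.
apply: wt_leZ => m; rewrite mpoly.mcoeff1.
case: (m =P 0%MM) => [-> _|]; last by rewrite eqxx.
by rewrite /wt !mnm0E.
Qed.

Lemma wt_le_int (j : int) : wt_le 0 (j%:~R : R).
Proof. by rewrite -(rmorph_int (in_alg R)); apply: wt_le_scalar. Qed.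

Definition rep_le n (f : V) := forall j, wt_le n (f j).

(** Derivatives never raise the weight, and every term of an operator has at most
    one of the last three variables too many. *)
Lemma rep_le_ops n f : rep_le n f ->
  [/\ rep_le n (@op_G k R f), rep_le n (@op_T k R f), rep_le n (op_X (var 0) f)
    & rep_le n (op_U (var 1) f)] /\
  [/\ rep_le n.+1 (rep_E f), rep_le n.+1 (rep_V f) & rep_le n.+1 (rep_Z f)].
Proof.
move=> hf.
have M0 a b : wt_le 0 a -> wt_le n b -> wt_le n (a * b).
  by move=> ha hb; rewrite -[n]add0n; apply: wt_leM.
have M1 a b : wt_le 1 a -> wt_le n b -> wt_le n.+1 (a * b).
  by move=> ha hb; rewrite -[n.+1]add1n; apply: wt_leM.
have W a : wt_le n a -> wt_le n.+1 a by apply: wt_leW.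
have B a b : wt_le n.+1 a -> wt_le n.+1 b -> wt_le n.+1 (a - b).
  by move=> ha hb; apply: wt_leD => //; apply: wt_leN.
have D i p : wt_le n p -> wt_le n (der i p) := @wt_le_der n i p.
have v0 : wt_le 0 (var 0) := @wt_le_var 0 isT.
have v1 : wt_le 0 (var 1) := @wt_le_var 1 isT.
have v2 : wt_le 1 (var 2) := @wt_le_var 2 isT.
have v3 : wt_le 1 (var 3) := @wt_le_var 3 isT.
have v4 : wt_le 1 (var 4) := @wt_le_var 4 isT.
split; split=> j; rewrite /rep_E /rep_V /rep_Z.
- exact: hf.
- exact: hf.
- exact/M0.
- exact/M0.
- rewrite /op_E.
  apply: (B); last exact/W/D.
  apply: wt_leD; last exact/W/D.
  apply: wt_leD; last by apply/W/M0; [apply: wt_le_int|apply: (M0)].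
  apply: wt_leD; first exact: M1.
  by apply/W/M0; [apply: wt_le_scalar|do 2!apply: (M0) => //; apply: (D)].
- rewrite /op_V.
  apply: (B); last by apply/W/M0; [apply: wt_le_scalar|do 2!apply: (M0) => //; apply: (D)].
  apply: (B); last by apply/W/M0; [apply: wt_le_int|apply: (M0)].
  apply: (B); last exact/W/D.
  apply: wt_leD; last exact/W/D.
  apply: (B); last by rewrite -[n.+1]add0n; apply: wt_leM;
    [apply: wt_le_scalar|apply: (M1) => //; do 2!apply: (D)].
  apply: wt_leD; last by apply: (M1) => //; do 2!apply: (D).
  by apply: (B); apply: (M1) => //; apply: (D).
- rewrite /op_Z.
  apply: (B); last by apply/W/M0 => //; apply: (D).
  apply: wt_leD; last by apply/W/M0 => //; apply: (D).
  apply: (B); last by apply: (M1) => //; apply: (D).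
  by apply: wt_leD; apply: (M1) => //; apply: (D).
Qed.

Lemma rep_le_vac : rep_le 0 (vac R).
Proof.
move=> j; rewrite /vac; case: eqP => _; last exact: wt_le0.
by rewrite -[1]scale1r; apply: wt_le_scalar.
Qed.

End PolynomialRepresentation.

(** * The associated graded algebra is a Laurent polynomial algebra *)

Section UniversalSmash.
Variables (k : fieldType) (A : algType k) (g t X u e v z : A).
Hypothesis two_neq0 : 2%:R != 0 :> k.
Hypothesis S : smash_rel g t X u e v z.
(** The universal property is what provides the representation. *)
Hypothesis A_lift : forall (B : algType k) (g' t' X' u' e' v' z' : B),
  smash_rel g' t' X' u' e' v' z' ->
  exists f : {lrmorphism A -> B}, [/\ f g = g', f t = t', f X = X' & f u = u'] /\
    [/\ f e = e', f v = v' & f z = z'].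

Local Notation R := (mpoly.mpoly 5 k).
Local Notation F := (FA g t X u e v z).
Local Notation lsym := (letter_symbol g t X u e v z).

Definition mono (i : nat) (m : mpoly.multinom 5) : A :=
  t ^+ i * (X ^+ m (o5 0) * (u ^+ m (o5 1) * (e ^+ m (o5 2) *
    (v ^+ m (o5 3) * z ^+ m (o5 4))))).

Lemma FA_exp n a j : F n a -> F (n * j)%N (a ^+ j).
Proof.
move=> Fa; elim: j => [|j IHj]; first by rewrite muln0; apply: (fil1 F).
by rewrite exprS mulnS; apply: (filM (f := F)).
Qed.

Lemma symbol_exp n a j : F n a -> symbol F (n * j) (a ^+ j) = symbol F n a ^+ j.
Proof.
move=> Fa; elim: j => [|j IHj]; first by rewrite muln0 symbol1.
by rewrite !exprS mulnS -IHj symbolM //; apply: FA_exp.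
Qed.

Lemma mono_symbol i m :
  F (wt m) (mono i m) /\ symbol F (wt m) (mono i m) =
    lsym 1 ^+ i * mpoly.mmap1 (fun j : 'I_5 => lsym j.+2) m.
Proof.
have L j := FA_letter g t X u e v z j.
have E n a b c d :
    F n a /\ symbol F n a = b -> forall l, F l c /\ symbol F l c = d ->
    F (l + n)%N (c * a) /\ symbol F (l + n)%N (c * a) = d * b.
  move=> [Fa <-] l [Fc <-]; split; first exact: (filM (f := F)).
  by rewrite symbolM.
have P j d : F (letter_weight j * d)%N (letter g t X u e v z j ^+ d) /\
    symbol F (letter_weight j * d) (letter g t X u e v z j ^+ d) = lsym j ^+ d.
  by split; [apply: FA_exp|rewrite symbol_exp].
rewrite /mpoly.mmap1 prod5 !inordK //.
have := E _ _ _ _ _ (E _ _ _ _ _ (E _ _ _ _ _ (E _ _ _ _ _ (E _ _ _ _ _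
  (P 6 (m (o5 4))) _ (P 5 (m (o5 3)))) _ (P 4 (m (o5 2)))) _
  (P 3 (m (o5 1)))) _ (P 2 (m (o5 0)))) _ (P 1%N i).
rewrite [X in symbol F X](_ : _ = wt m); last first.
  by rewrite /wt /letter_weight /=; lia.
by rewrite [X in fil F X](_ : _ = wt m) //; rewrite /wt /letter_weight /=; lia.
Qed.

(** The form is the coefficient of [T^i X^m] in [a . 1], for the action of [a] on
    the polynomial representation.  It kills the elements of smaller weight
    because the action is filtered. *)
Lemma coefficient_form (i : nat) (m : mpoly.multinom 5) :
  exists phi : {linear A -> k^o},
    (forall a, fil_pred F (wt m) a -> phi a = 0) /\
    (forall j n, phi (mono j n) = ((j == i) && (n == m))%:R).
Proof.
have [g' [t' [X' [U' [E' [W' [Z' [S' [hg ht hX hU] [hE hW hZ] hmono]]]]]]]] :=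
  polynomial_representation two_neq0.
have [f [[fg ft fX fu] [fe fv fz]]] := A_lift S'.
pose e0 (a : A) : k^o := mpoly.mcoeff m (f a (vac R) i%:Z).
have eB : zmod_morphism e0.
  by move=> a b; rewrite /e0 raddfB lendDE lendNE -mpoly.mcoeffB.
have eZ : scalable e0.
  by move=> c a; rewrite /e0 linearZ lendZE; apply: mpoly.mcoeffZ.
pose m1 := GRing.isZmodMorphism.Build _ _ e0 eB.
pose m2 := GRing.isScalable.Build _ _ _ _ e0 eZ.
pose phi : {linear A -> k^o} := HB.pack e0 m1 m2.
exists phi; split=> [|j n]; last first.
  have fmono : f (mono j n) =
      t' ^+ j * (X' ^+ n (o5 0) * (U' ^+ n (o5 1) * (E' ^+ n (o5 2) *
      (W' ^+ n (o5 3) * Z' ^+ n (o5 4))))).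
    by rewrite /mono -ft -fX -fu -fe -fv -fz !(rmorphM, rmorphXn).
  rewrite [LHS](_ : _ = e0 (mono j n)) // /e0 fmono hmono.
  rewrite /single; case: eqVneq => [/eqP|] ij.
    by rewrite eqz_nat eq_sym in ij; rewrite ij mpoly.mcoeffX.
  by rewrite eqz_nat eq_sym in ij; rewrite (negbTE ij) mpoly.mcoeff0.
have opw w d V : rep_le d V -> rep_le (weight w + d) (f (word g t X u e v z w) V).
  move=> hV; elim: w => [|j w IHw].
    by rewrite /word /weight !big_nil rmorph1 lend1E.
  rewrite word_cons weight_cons rmorphM lendME -addnA.
  have [[h0 h1 h2 h3] [h4 h5 h6]] := rep_le_ops IHw.
  case: j => [|[|[|[|[|[|[|j]]]]]]]; rewrite /letter /letter_weight /=.
  - by rewrite fg; move=> l; rewrite hg; apply: h0.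
  - by rewrite ft; move=> l; rewrite ht; apply: h1.
  - by rewrite fX; move=> l; rewrite hX; apply: h2.
  - by rewrite fu; move=> l; rewrite hU; apply: h3.
  - by rewrite fe; move=> l; rewrite hE; apply: h4.
  - by rewrite fv; move=> l; rewrite hW; apply: h5.
  - by rewrite fz; move=> l; rewrite hZ; apply: h6.
  - rewrite nth_nil rmorph1 lend1E => l; apply: wt_leW (IHw l).
    exact: leq_addl.
have opF n a : F n a -> rep_le n (f a (vac R)).
  elim=> [|c w {}a wn _ IH] l.
    by rewrite raddf0; apply: wt_le0.
  rewrite linearP lendDE lendZE; apply: wt_leD (IH l).
  apply: wt_leZ; apply: wt_leW wn _; rewrite -[weight w]addn0.
  exact: opw (@rep_le_vac k) l.
move=> a; case wm: (wt m) => [|n] /=.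
  by move=> ->; exact (raddf0 phi).
move=> /opF/(_ i%:Z)/(_ m) h; apply/eqP/negPn/negP => /h.
by rewrite wm ltnn.
Qed.

(** Of [laurent_mpoly k 5] only the generators and the universal property
    matter. *)
Variables (Lam : algType k) (T Ti : Lam) (LX : 'I_5 -> Lam).
Hypothesis Lam_comm : forall a b : Lam, a * b = b * a.
Hypotheses (TK : T * Ti = 1) (TKV : Ti * T = 1).
Hypothesis Lam_ind : forall P : Lam -> Prop,
    P 1 -> (forall a b, P a -> P b -> P (a + b)) ->
    (forall a b, P a -> P b -> P (a * b)) -> (forall c a, P a -> P (c *: a)) ->
    P T -> P Ti -> (forall i, P (LX i)) ->
  forall a, P a.
Hypothesis Lam_lift : forall (B : algType k) (tau taui : B) (s : 'I_5 -> B),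
    (forall a b : B, a * b = b * a) -> tau * taui = 1 ->
  exists f : {lrmorphism Lam -> B},
    [/\ f T = tau, f Ti = taui & forall i, f (LX i) = s i].

(** Any element of [Lam] becomes a polynomial [nu q] in [T] and the [X_j] after
    multiplication by a power of [T]; coefficient forms show that [Pi] is
    injective on such polynomials, hence on [Lam]. *)
Theorem gr_iso :
  exists (Pi : {lrmorphism Lam -> gr F}) (nu : {rmorphism {poly R} -> Lam}),
  [/\ bijective Pi, injective nu &
      forall l, exists N q, T ^+ N * l = nu q].
Proof.
have comm := gr_comm S.
have tau1 : lsym 1 * lsym 0 = 1.
  rewrite /letter_symbol symbolM; last exact: (FA_letter _ _ _ _ _ _ _ 0).
    by rewrite /= (sm_tg S) symbol1.
  exact: (FA_letter _ _ _ _ _ _ _ 1).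
have [Pi [PT PTi PX]] := Lam_lift (fun j : 'I_5 => lsym j.+2) comm tau1.
have [nu [nuT nuX nuc nuE]] := poly_mpoly_lift Lam_comm T LX.
have PE j n : Pi (T ^+ j * mpoly.mmap1 LX n) =
    lsym 1 ^+ j * mpoly.mmap1 (fun l : 'I_5 => lsym l.+2) n.
  rewrite -PT rmorphM rmorphXn; congr (_ * _); rewrite /mpoly.mmap1 rmorph_prod.
  by apply: eq_bigr => l _; rewrite -PX rmorphXn.
have coef0 q : Pi (nu q) = 0 -> q = 0.
  move=> Pq; apply/polyP => i; rewrite coef0; apply/mpoly.mpolyP => m.
  rewrite mpoly.mcoeff0; have [phi [phi0 phiE]] := coefficient_form i m.
  have [psi psiE] := gr_functional phi0.
  have : psi (Pi (nu q)) = 0 by rewrite Pq raddf0.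
  have lin c a : psi (Pi (c *: a)) = c * psi (Pi a) by rewrite !linearZ.
  rewrite nuE !raddf_sum /=.
  have -> : \sum_(j < size q) psi (Pi (\sum_(n <- mpoly.msupp q`_j)
      mpoly.mcoeff n q`_j *: (T ^+ j * mpoly.mmap1 LX n))) =
    \sum_(j < size q) (if j == i :> nat then mpoly.mcoeff m q`_j else 0).
    apply: eq_bigr => j _; rewrite !raddf_sum /=.
    have E n : psi (Pi (mpoly.mcoeff n q`_j *: (T ^+ j * mpoly.mmap1 LX n))) =
        if (j == i :> nat) && (n == m) then mpoly.mcoeff n q`_j else 0.
      rewrite lin PE.
      have [Fm <-] := mono_symbol j n; rewrite psiE // phiE.
      case: andP => [[_ /eqP ->]|_]; last by rewrite if_same mulr0.
      by rewrite eqxx mulr1.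
    under eq_bigr do rewrite E.
    case: eqP => _ /=; last by rewrite big1.
    have [mq|mq] := boolP (m \in mpoly.msupp q`_j).
      rewrite (bigD1_seq m) ?mpoly.msupp_uniq //= eqxx big1 ?addr0 // => n.
      by move=> /negbTE ->.
    rewrite mpoly.memN_msupp_eq0 // big_seq big1 // => n nq.
    by case: eqP => // nm; rewrite -nm nq in mq.
  have [iq|iq] := ltnP i (size q); last first.
    by rewrite nth_default // mpoly.mcoeff0.
  rewrite (bigD1 (Ordinal iq)) //= eqxx big1 ?addr0 // => j.
  by rewrite -val_eqE /= => /negbTE ->.
have nu_inj : injective nu.
  by apply: raddf_inj => q nq; apply: coef0; rewrite nq raddf0.
have frac l : exists N q, T ^+ N * l = nu q.
  have comL := Lam_comm.
  elim/Lam_ind: l => [|a b [N [q Na]] [M [r Mb]]|a b [N [q Na]] [M [r Mb]]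
    |c a [N [q Na]]|||i].
  - by exists 0%N, 1; rewrite rmorph1 mulr1.
  - exists (N + M)%N, ('X^M * q + 'X^N * r).
    rewrite rmorphD !rmorphM !rmorphXn nuT -Na -Mb mulrDr !mulrA -!exprD.
    by rewrite [(M + N)%N]addnC.
  - exists (N + M)%N, (q * r); rewrite rmorphM -Na -Mb exprD -!mulrA.
    by congr (_ * _); rewrite !mulrA [_ * a]comL.
  - exists N, ((c%:A)%:P * q).
    by rewrite rmorphM nuc -Na mulr_algl scalerAr.
  - by exists 0%N, 'X; rewrite mul1r nuT.
  - by exists 1%N, 1; rewrite rmorph1 expr1 TK.
  - by exists 0%N, (mpoly.mpolyX k U_(i)%MM)%:P; rewrite mul1r nuX.
have lamT_cancel N a : T ^+ N * a = 0 -> a = 0.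
  move=> h; have : Ti ^+ N * (T ^+ N * a) = 0 by rewrite h mulr0.
  rewrite mulrA -exprMn_comm; last exact: Lam_comm.
  by rewrite TKV expr1n mul1r.
have Pi_inj : injective Pi.
  apply: raddf_inj => l Pl; have [N [q Nq]] := frac l.
  by apply: (@lamT_cancel N); rewrite Nq (coef0 q) ?raddf0 // -Nq rmorphM Pl mulr0.
have Pi_surj w : exists l, Pi l = w.
  elim/(gr_letters_ind (g := g)) : w => [|a b [l <-] [l' <-]
    |a b [l <-] [l' <-]|c a [l <-]|[|[|i]] i7].
  - by exists 1; rewrite rmorph1.
  - by exists (l + l'); rewrite rmorphD.
  - by exists (l * l'); rewrite rmorphM.
  - by exists (c *: l); rewrite linearZ.
  - by exists (Ti).
  - by exists T.
  - by exists (LX (Ordinal (i7 : i < 5)%N)); rewrite PX.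
exists Pi, nu; split=> //.
have [h hP] := choice Pi_surj.
by exists h => // l; apply: Pi_inj.
Qed.

(** Clearing powers of [T] reduces this to polynomials. *)
Lemma gr_domain : forall a b : gr F, a * b = 0 -> a = 0 \/ b = 0.
Proof.
have [Pi [nu [[h hK Kh] nu_inj frac]]] := gr_iso.
have T_cancel N a : T ^+ N * a = 0 -> a = 0.
  move=> Ta; have : Ti ^+ N * (T ^+ N * a) = 0 by rewrite Ta mulr0.
  rewrite mulrA -exprMn_comm; last exact: Lam_comm.
  by rewrite TKV expr1n mul1r.
move=> a b; rewrite -[a]Kh -[b]Kh -rmorphM => ab0.
have {ab0} : h a * h b = 0 by apply: (can_inj hK); rewrite ab0 raddf0.
have [N [q Nq]] := frac (h a); have [M [r Mr]] := frac (h b) => ab0.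
have : q * r = 0.
  apply: nu_inj; rewrite rmorphM -Nq -Mr rmorph0 -mulrA [h a * _]mulrA.
  by rewrite [h a * _]Lam_comm -mulrA ab0 !mulr0.
move/eqP; rewrite mulf_eq0 => /orP[]/eqP z0; [left|right].
  by rewrite (@T_cancel N (h a)) ?raddf0 // Nq z0 raddf0.
by rewrite (@T_cancel M (h b)) ?raddf0 // Mr z0 raddf0.
Qed.

End UniversalSmash.

(** * The center in characteristic p *)

Section Characteristic.
Variables (k : fieldType) (A : algType k) (p : nat).
Hypothesis char_k : p \in [pchar k].
Implicit Types (a b c : A).

Lemma scale_p0 a : a *+ p = 0.
Proof. by rewrite -scaler_nat (pcharf0 char_k) scale0r. Qed.

Lemma commutator_exp a b c n : a * b = b * a + c -> c * b = b * c ->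
  a * b ^+ n.+1 = b ^+ n.+1 * a + (c * b ^+ n) *+ n.+1.
Proof.
move=> ab cb; elim: n => [|n IHn]; first by rewrite !expr1 expr0 mulr1.
have cbn m : c * b ^+ m = b ^+ m * c by apply: commrX.
rewrite exprSr mulrA IHn mulrDl -mulrA ab mulrDr mulrA -exprSr -addrA.
congr (_ + _); rewrite -cbn -{1}[c * _]mulr1n mulrnAl -mulrA -exprSr.
by rewrite -mulrnDr add1n.
Qed.

Lemma commute_exp_char a b c : a * b = b * a + c -> c * b = b * c ->
  a * b ^+ p = b ^+ p * a.
Proof.
move=> ab cb; have p0 : (0 < p)%N by apply/prime_gt0/(pcharf_prime char_k).
by have := commutator_exp p.-1 ab cb; rewrite prednK // scale_p0 addr0.
Qed.

Definition ad a b := a * b - b * a.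

Fact lmul_linear a : linear (fun b : A => a * b).
Proof. by move=> c x y; rewrite mulrDr scalerAr. Qed.
Fact rmul_linear a : linear (fun b : A => b * a).
Proof. by move=> c x y; rewrite mulrDl scalerAl. Qed.

(** [ad a] is the difference of the commuting operators of left and right
    multiplication, so its [p]-th power is computed by the Frobenius map. *)
Lemma ad_exp_char a b : a ^+ p * b - b * a ^+ p = iter p (ad a) b.
Proof.
pose E := lend (oner_neq0 A).
pose L : E := Lend _ (lmul_linear a); pose Q : E := Lend _ (rmul_linear a).
have char_E : p \in [pchar E].
  rewrite inE (pcharf_prime char_k) /=; apply/eqP.
  by rewrite -scaler_nat (pcharf0 char_k) scale0r.
have LQ : GRing.comm L Q by apply: lendP => x /=; rewrite /= mulrA.
have Lp n x : (L ^+ n) x = a ^+ n * x.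
  rewrite lendXE; elim: n => [|n IHn] /=; first by rewrite mul1r.
  by rewrite IHn mulrA -exprS.
have Qp n x : (Q ^+ n) x = x * a ^+ n.
  rewrite lendXE; elim: n => [|n IHn] /=; first by rewrite mulr1.
  by rewrite IHn -mulrA -exprSr.
have := congr1 (fun f : E => f b) (pFrobenius_autB_comm char_E LQ).
rewrite !pFrobenius_autE lendDE lendNE Lp Qp lendXE => <-.
exact: eq_iter.
Qed.

(** On powers of [b], [ad a] is [h b^2 d/db]. *)
Lemma adX a b (h : k) n :
  ad a b = h *: b ^+ 2 -> ad a (b ^+ n) = (n%:R * h) *: b ^+ n.+1.
Proof.
move=> ab; have {}ab : a * b = b * a + h *: b ^+ 2 by rewrite -ab addrC subrK.
case: n => [|n]; first by rewrite /ad mulr1 mul1r subrr mul0r scale0r.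
rewrite /ad (commutator_exp n ab); last by rewrite -scalerAl -scalerAr -exprSr -exprS.
rewrite addrAC subrr add0r -scalerAl -exprD -scaler_nat scalerA.
by rewrite add2n.
Qed.

Lemma adM a b c : ad a (b * c) = ad a b * c + b * ad a c.
Proof. by rewrite /ad mulrBl mulrBr !mulrA addrA subrK. Qed.

Lemma adD a b c : ad a (b + c) = ad a b + ad a c.
Proof. by rewrite /ad mulrDr mulrDl opprD addrACA. Qed.

Lemma adZ a (d : k) b : ad a (d *: b) = d *: ad a b.
Proof. by rewrite /ad -scalerAr -scalerAl scalerBr. Qed.

Lemma ad_iter0 a b m n : (m <= n)%N -> iter m (ad a) b = 0 -> iter n (ad a) b = 0.
Proof.
move=> /subnK <- h; rewrite iterD h; elim: (n - m)%N => //= i ->.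
by rewrite /ad mulr0 mul0r subrr.
Qed.

Variables (g t X u e v z : A).

(** The symmetry that exchanges the two nilpotent directions of sl2. *)
Lemma smash_swap : smash_rel g t X u e v z ->
  smash_rel g t (- u) (- X) v e (- z).
Proof.
case=> hgt htg hXt hut huX het heX heu hzt hzX hzu hvt hvX hvu hze hzv hev.
split=> //; rewrite ?mulNr ?mulrN ?opprK ?sqrrN.
- by rewrite hut.
- by rewrite hXt.
- by rewrite huX.
- by rewrite hvt.
- by rewrite hvu opprB addrC.
- by rewrite hvX opprD opprB.
- by rewrite hzt.
- by rewrite hzu.
- by rewrite hzX.
- by rewrite het.
- by rewrite heu opprD opprB.
- by rewrite heX opprD.
- by rewrite hzv opprB addrC.
- by rewrite hze opprD.
- by rewrite hev addrK.
Qed.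

Hypothesis p_gt2 : (2 < p)%N.
Hypothesis S : smash_rel g t X u e v z.

Let h : k := 2%:R^-1.
Let h2 : h *+ 2 = 1.
Proof.
rewrite -mulr_natr mulVf //; apply/negP => two0.
have : (p %| 2)%N by rewrite (dvdn_pcharf char_k).
by move=> /(dvdn_leq (isT : 0 < 2)%N); rewrite leqNgt p_gt2.
Qed.

Let p0 : p%:R = 0 :> k. Proof. exact: pcharf0 char_k. Qed.
Let p_gt0 : (0 < p)%N. Proof. by apply: leq_trans p_gt2. Qed.

Lemma ad_e_X n : iter n (ad e) X = (n`!%:R * h ^+ n) *: X ^+ n.+1.
Proof.
elim: n => [|n IHn]; first by rewrite mul1r scale1r.
have eX : ad e X = h *: X ^+ 2 by rewrite /ad (sm_eX S) addrAC subrr add0r.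
rewrite iterS IHn adZ (adX n.+1 eX) scalerA factS natrM [h ^+ n.+1]exprS.
congr (_ *: _).
by ring.
Qed.

Lemma ad_e_t n : iter n (ad e) t = (n.+1`!%:R * h ^+ n) *: (t * X ^+ n).
Proof.
elim: n => [|n IHn]; first by rewrite mul1r scale1r mulr1.
have eX : ad e X = h *: X ^+ 2 by rewrite /ad (sm_eX S) addrAC subrr add0r.
have et : ad e t = t * X by rewrite /ad (sm_et S) addrAC subrr add0r.
rewrite iterS IHn adZ adM et (adX n eX) -mulrA -exprS -scalerAr.
rewrite -[X in X + _]scale1r -scalerDl scalerA; congr (_ *: _).
rewrite [in RHS]factS [in RHS]natrM [h ^+ n.+1]exprS.
(* h *+ 2 + n h = (n + 2) h *)
rewrite -[X in X + _]h2 -[n.+2%:R]natr1 -[n.+1%:R]natr1.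
by ring.
Qed.

(** The iterates of [ad(e)] acquire factorials on [X] and [t], which vanish at
    [p]; [u] is sent to [1 - t], and [ad(e)^3] kills sl2, whence [p > 2]. *)
Lemma exp_e_central b : b \in [:: g; t; X; u; e; v; z] -> e ^+ p * b = b * e ^+ p.
Proof.
have nil a : iter p (ad e) a = 0 -> e ^+ p * a = a * e ^+ p.
  by move=> a0; apply/eqP; rewrite -subr_eq0 ad_exp_char a0.
have p1 : (p.-1 < p)%N by rewrite prednK.
have facp n : (p <= n)%N -> n`!%:R = 0 :> k.
  move=> pn; apply/eqP; rewrite -(dvdn_pcharf char_k); apply: dvdn_fact.
  by rewrite p_gt0.
have adt : iter p.-1 (ad e) t = 0.
  by rewrite ad_e_t facp ?prednK // mul0r scale0r.
have et : e ^+ p * t = t * e ^+ p by apply/nil/(ad_iter0 (leq_pred p)).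
have ez : iter 2 (ad e) z = 0.
  have -> : iter 2 (ad e) z = ad e (- e).
    by rewrite /= {2}/ad (sm_ze S) opprD addrA subrr add0r.
  by rewrite /ad mulrN mulNr subrr.
rewrite !inE; do ![case/orP] => /eqP ->.
- by rewrite -[LHS]mul1r -(sm_gt S) -mulrA (mulrA t) -et -mulrA (sm_tg S) mulr1.
- exact: et.
- by apply: nil; rewrite ad_e_X facp // mul0r scale0r.
- apply: nil; rewrite -(prednK p_gt0) iterSr {2}/ad (sm_eu S) addrAC subrr add0r.
  have iterB n a b' : iter n (ad e) (a - b') = iter n (ad e) a - iter n (ad e) b'.
    by elim: n => //= n ->; rewrite adD -scaleN1r adZ scaleN1r.
  rewrite iterB adt subr0; apply: (@ad_iter0 _ _ 1).
    by rewrite -ltnS prednK // ltnW.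
  by rewrite /= /ad mulr1 mul1r subrr.
- by rewrite -exprSr -exprS.
- apply: nil; apply: (@ad_iter0 _ _ 3) => //; rewrite iterSr.
  by rewrite {2}/ad (sm_ev S) addrAC subrr add0r.
- by apply: nil; apply: (ad_iter0 _ ez); apply: ltnW.
Qed.

End Characteristic.

(** * Finiteness over the center *)

(** A finitely generated central subalgebra, as the image of an iterated
    polynomial ring. *)
Lemma central_noetherian_image (k : fieldType) (A : algType k) (cs : seq A) :
    (forall c a, c \in cs -> c * a = a * c) ->
  exists (C : comNzRingType) (chi : {rmorphism C -> A}),
    [/\ left_noetherian C, forall c a, chi c * a = a * chi c,
        forall d : k, exists c, chi c = d%:A
      & forall x, x \in cs -> exists c, chi c = x].
Proof.
elim: cs => [|x cs IHcs] csC.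
  exists k, (in_alg A); split=> //; first exact: field_left_noetherian.
    by move=> c a; rewrite mulr_algl mulr_algr.
  by move=> d; exists d.
have [|C [chi [noethC chiC chik chics]]] := IHcs.
  by move=> c a cc; apply: csC; rewrite inE cc orbT.
have xC : commr_rmorph chi x by move=> c; rewrite /GRing.comm chiC.
have x_central a : x * a = a * x by apply: csC; rewrite inE eqxx.
exists {poly C}, (horner_morph xC); split.
- exact: hilbert_basis.
- move=> q a; elim/poly_ind: q => [|q c IHq]; first by rewrite rmorph0 mul0r mulr0.
  rewrite rmorphD rmorphM /= horner_morphX horner_morphC mulrDl mulrDr chiC.
  by congr (_ + _); rewrite -mulrA x_central mulrA IHq -mulrA.
- by move=> d; have [c <-] := chik d; exists c%:P; apply: horner_morphC.
- move=> y; rewrite inE => /predU1P[->|/chics[c <-]].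
    by exists 'X; apply: horner_morphX.
  by exists c%:P; apply: horner_morphC.
Qed.

Section Powers.
Variables (C : comNzRingType) (A : nzRingType) (chi : {rmorphism C -> A}).
Hypothesis chi_central : forall c a, chi c * a = a * chi c.

Definition pows (p : nat) (b : A) : seq A := [seq b ^+ i | i <- iota 0 p].

Lemma mem_pows p b i : (i < p)%N -> b ^+ i \in pows p b.
Proof. by move=> ip; apply: map_f; rewrite mem_iota. Qed.

(** If [b^p] is a combination of lower powers, so is every power. *)
Lemma cspan_pows p b n : cspan chi (pows p b) (b ^+ p) ->
  (0 < p)%N -> cspan chi (pows p b) (b ^+ n).
Proof.
move=> bp p0; elim: n => [|n]; first by apply/cspan_mem/mem_pows.
rewrite exprS; elim=> [|c x a /mapP[i]]; first by rewrite mulr0; constructor.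
rewrite mem_iota add0n => /andP[_ ip] -> _ IH.
rewrite mulrDr mulrA -chi_central -mulrA -exprS; apply: cspan_add => //.
apply: cspan_scale; move: ip; rewrite leq_eqVlt => /orP[/eqP -> //|ip].
by apply/cspan_mem/mem_pows.
Qed.

End Powers.

Section FiniteOverCenter.
Variables (k : fieldType) (A : algType k) (p : nat).
Hypotheses (char_k : p \in [pchar k]) (p_gt2 : (2 < p)%N).
Variables (g t X u e v z : A).
Hypothesis S : smash_rel g t X u e v z.
Hypothesis A_gen : generated_by (fun a => a \in [:: g; t; X; u; e; v; z]).

Local Notation F := (FA g t X u e v z).
Local Notation L := (letter g t X u e v z).
Local Notation wd := (word g t X u e v z).
Local Notation gens := [:: g; t; X; u; e; v; z].

Lemma commute_gens_central a :
  (forall b, b \in gens -> a * b = b * a) -> forall b, a * b = b * a.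
Proof.
move=> ag; apply: A_gen => [|b c ab ac|b c ab ac|d b ab|b /ag //].
- by rewrite mulr1 mul1r.
- by rewrite mulrDr mulrDl ab ac.
- by rewrite mulrA ab -mulrA ac mulrA.
- by rewrite -scalerAr ab scalerAl.
Qed.

Definition central_gens : seq A :=
  [:: g ^+ p; t ^+ p; X ^+ p; u ^+ p; e ^+ p; v ^+ p; z ^+ p - z].

Let odd_p : odd p.
Proof.
by case: (even_prime (pcharf_prime char_k)) p_gt2 => [->|//].
Qed.

(** [t^p], [X^p] and [u^p] are handled by [commute_exp_char], [g^p] is the inverse
    of [t^p], [e^p] and [v^p] follow from [exp_e_central] and the symmetry, and
    [zeta] acts diagonally with eigenvalues 0, 1 and -1, so that
    [ad(zeta)^p = ad(zeta)] as [p] is odd. *)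
Lemma central_gensP c a : c \in central_gens -> c * a = a * c.
Proof.
move=> cc; apply: commute_gens_central a => b hb.
have [hgt htg hXt hut huX het heX heu hzt hzX hzu hvt hvX hvu hze hzv hev] := S.
have pow0 (a c' : A) : a * c' = c' * a -> c' ^+ p * a = a * c' ^+ p.
  by move=> ac; apply/commr_sym/commrX.
have pow (a c' d : A) : a * c' = c' * a + d -> d * c' = c' * d ->
    c' ^+ p * a = a * c' ^+ p.
  by move=> h1 h2; rewrite (commute_exp_char char_k h1 h2).
have X2 (c' : k) (y : A) : (c' *: y ^+ 2) * y = y * (c' *: y ^+ 2).
  by rewrite -scalerAl -scalerAr -exprSr -exprS.
have tp b' : b' \in gens -> t ^+ p * b' = b' * t ^+ p.
  rewrite !inE; do ![case/orP] => /eqP ->.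
  - by apply: pow0; rewrite hgt htg.
  - exact: pow0.
  - exact: pow0.
  - exact: pow0.
  - by apply: pow het _; rewrite -mulrA hXt.
  - by apply: (pow _ _ (- (t * u))); rewrite ?hvt // mulNr mulrN -mulrA hut.
  - exact: pow0.
move: cc; rewrite !inE; do ![case/orP] => /eqP ->.
- have gtp : g ^+ p * t ^+ p = 1.
    by rewrite -exprMn_comm ?hgt ?expr1n // /GRing.comm hgt htg.
  have tgp : t ^+ p * g ^+ p = 1.
    by rewrite -exprMn_comm ?htg ?expr1n // /GRing.comm hgt htg.
  have <- : g ^+ p * t ^+ p * b * g ^+ p = b * g ^+ p by rewrite gtp mul1r.
  by rewrite -!mulrA (mulrA (t ^+ p)) tp // -mulrA tgp mulr1.
- exact: tp.
- move: hb; rewrite !inE; do ![case/orP] => /eqP ->.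
  + by apply: pow0; rewrite (sm_Xg S).
  + by apply: pow0; rewrite hXt.
  + by apply: pow0.
  + exact: pow0.
  + exact: pow heX (X2 _ _).
  + by apply: pow hvX _; rewrite mulrBl mulrBr mulr1 mul1r hXt.
  + exact: pow hzX _.
- move: hb; rewrite !inE; do ![case/orP] => /eqP ->.
  + by apply: pow0; rewrite (sm_ug S).
  + by apply: pow0; rewrite hut.
  + by apply: pow0; rewrite huX.
  + by apply: pow0.
  + by apply: pow heu _; rewrite mulrBl mulrBr mulr1 mul1r hut.
  + by apply: pow hvu _; rewrite mulNr mulrN X2.
  + by apply: pow hzu _; rewrite mulNr mulrN.
- exact: (exp_e_central char_k p_gt2 S).
- have C := exp_e_central char_k p_gt2 (smash_swap S).
  have N (a : A) : v ^+ p * - a = - a * v ^+ p -> v ^+ p * a = a * v ^+ p.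
    by rewrite mulrN mulNr => /oppr_inj.
  move: hb; rewrite !inE; do ![case/orP] => /eqP ->.
  + by apply: C; rewrite !inE eqxx.
  + by apply: C; rewrite !inE eqxx ?orbT.
  + by apply/N/C; rewrite !inE eqxx ?orbT.
  + by apply/N/C; rewrite !inE eqxx ?orbT.
  + by apply: C; rewrite !inE eqxx ?orbT.
  + by apply: C; rewrite !inE eqxx ?orbT.
  + by apply/N/C; rewrite !inE eqxx ?orbT.
- have sgn n d (a : A) : ad z a = (-1) ^+ d *: a ->
      iter n (ad z) a = ((-1) ^+ d) ^+ n *: a.
    move=> za; elim: n => [|n IHn]; first by rewrite scale1r.
    by rewrite iterS IHn adZ za scalerA -exprSr.
  have fin (a : A) : iter p (ad z) a = ad z a -> (z ^+ p - z) * a = a * (z ^+ p - z).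
    move=> za; have E : z ^+ p * a = a * z ^+ p + (z * a - a * z).
      by rewrite -[z * a - a * z]za -ad_exp_char // addrC subrK.
    by rewrite mulrBl mulrBr E -addrA; congr (_ + _); rewrite addrAC subrr add0r.
  have eig d (a : A) : ad z a = (-1) ^+ d *: a -> (z ^+ p - z) * a = a * (z ^+ p - z).
    move=> za; apply: fin; rewrite (sgn _ _ _ za) za -exprM mulnC exprM.
    by rewrite -signr_odd odd_p expr1.
  have zero (a : A) : z * a = a * z -> (z ^+ p - z) * a = a * (z ^+ p - z).
    by move=> za; rewrite mulrBl mulrBr za (pow0 _ _ (esym za)).
  move: hb; rewrite !inE; do ![case/orP] => /eqP ->.
  + by apply: zero; rewrite (sm_zg S).
  + exact: zero.
  + by apply: (eig 0%N); rewrite /ad hzX addrAC subrr add0r scale1r.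
  + by apply: (eig 1%N); rewrite /ad hzu addrAC subrr add0r scaleN1r.
  + by apply: (eig 0%N); rewrite /ad hze addrAC subrr add0r scale1r.
  + by apply: (eig 1%N); rewrite /ad hzv addrAC subrr add0r scaleN1r.
  + exact: zero.
Qed.

(** ** Sorting the letters of a word *)

Lemma prod_perm_comm (B : pzRingType) (f : nat -> B) (s s' : seq nat) :
    (forall a b : B, a * b = b * a) -> perm_eq s s' ->
  \prod_(i <- s) f i = \prod_(i <- s') f i.
Proof.
move=> BC ss'.
apply: (@catCA_perm_ind _ (fun r => \prod_(i <- s) f i = \prod_(i <- r) f i)
  _ s s') => // s1 s2 s3 ->.
by rewrite !big_cat /= !mulrA [X in X * _]BC.
Qed.

Definition sorted_word (w : seq nat) : seq nat :=
  flatten [seq nseq (count_mem j w) j | j <- iota 0 7].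

Lemma perm_sorted_word w : perm_eq [seq i <- w | (i < 7)%N] (sorted_word w).
Proof.
apply/allP => /= x _; apply/eqP.
have -> : count_mem x [seq i <- w | (i < 7)%N] = ((x < 7)%N * count_mem x w)%N.
  elim: w => [|i w IHw] /=; first by rewrite muln0.
  rewrite mulnDr -IHw; have [<-|/negbTE ix] := eqVneq i x.
    by case: (i < 7)%N; rewrite /= ?eqxx.
  by case: (i < 7)%N; rewrite /= ?ix muln0.
rewrite /sorted_word /= !count_cat !count_nseq /= !addn0.
case: x => [|[|[|[|[|[|[|x]]]]]]]; rewrite /= ?mul0n ?mul1n ?addn0 ?add0n //.
Qed.

Lemma word_filter w : wd [seq i <- w | (i < 7)%N] = wd w.
Proof.
elim: w => //= i w IHw; case: ltnP => i7; rewrite !word_cons IHw //.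
by rewrite [L i]nth_default // mul1r.
Qed.

Lemma weight_filter w : weight [seq i <- w | (i < 7)%N] = weight w.
Proof.
elim: w => //= i w IHw; case: ltnP => i7; rewrite !weight_cons IHw //.
by rewrite /letter_weight (ltnNge i) i7 andbF.
Qed.

Lemma weight_sorted w : weight (sorted_word w) = weight w.
Proof. by rewrite -[RHS]weight_filter; apply/esym/perm_big/perm_sorted_word. Qed.

(** The graded algebra being commutative, sorting a word does not change its
    symbol. *)
Lemma sub_sorted_word w :
  fil_pred F (weight w) (wd w - wd (sorted_word w)).
Proof.
have Fw x : F (weight x) (wd x) by apply: word_fil_word.
apply/symbol_eq; [exact: Fw|by rewrite -(weight_sorted w); apply: Fw|].
rewrite -{2}(weight_sorted w) -word_filter -weight_filter !symbol_word.
by apply: prod_perm_comm (perm_sorted_word w); apply: gr_comm.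
Qed.

(** By induction on the weight every word is a combination of sorted words, and
    each block of a sorted word is a combination of powers below [p]. *)
Theorem finite_over_center : exists (C : comNzRingType)
    (chi : {rmorphism C -> A}) (bs : seq A),
  [/\ left_noetherian C, forall c a, chi c * a = a * chi c
    & forall a, cspan chi bs a].
Proof.
have [C [chi [noethC chiC chik chics]]] := central_noetherian_image central_gensP.
pose basis := foldr (fun j bs => [seq b * b' | b <- pows p (L j), b' <- bs])
  [:: 1] (iota 0 7).
exists C, chi, basis; split=> //.
have p_gt0 : (0 < p)%N by apply: leq_trans p_gt2.
have one b : 1 \in pows p b by rewrite -(expr0 b); apply: mem_pows.
have span_exp j n : (j < 7)%N -> cspan chi (pows p (L j)) (L j ^+ n).
  move=> j7; apply: cspan_pows => //.
  have central x : x ^+ p \in central_gens -> cspan chi (pows p x) (x ^+ p).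
    move=> /chics[c <-]; rewrite -[chi c]mulr1; apply: cspan_scale.
    by apply: cspan_mem; apply: one.
  case: j j7 => [|[|[|[|[|[|[|j]]]]]]] // _; rewrite /letter /=;
    try by apply: central; rewrite !inE eqxx ?orbT.
  rewrite -[z ^+ p](subrK z); apply: cspan_add.
    have [|c <-] := chics (z ^+ p - z); first by rewrite !inE eqxx ?orbT.
    by rewrite -[chi c]mulr1; apply: cspan_scale; apply: cspan_mem; apply: one.
  by apply: cspan_mem; rewrite -{1}[z]expr1; apply: mem_pows; apply: ltnW.
have span_sorted w : cspan chi basis (wd (sorted_word w)).
  rewrite /sorted_word /basis.
  have : all (fun j => j < 7)%N (iota 0 7) by [].
  elim: (iota 0 7) => [_|j js IHjs /andP[j7 js7]].
    by rewrite /word big_nil; apply/cspan_mem/mem_head.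
  rewrite [flatten _]/= wordM; apply: cspan_mul => //; last exact: IHjs.
  have -> : wd (nseq (count_mem j w) j) = L j ^+ count_mem j w.
    by elim: (count_mem j w) => [|n IHn]; rewrite /word ?big_nil // big_cons
      -/(wd _) IHn exprS.
  exact: span_exp.
have spanZ (d : k) a : cspan chi basis a -> cspan chi basis (d *: a).
  by have [c cd] := chik d; rewrite -mulr_algl -cd; apply: cspan_scale.
have span_fil n : (forall w, (weight w <= n)%N -> cspan chi basis (wd w)) ->
    forall a, F n a -> cspan chi basis a.
  move=> span_w a; elim=> [|d w {}a wn _ IH]; first by constructor.
  by apply: cspan_add => //; apply/spanZ/span_w.
have span_word n w : (weight w <= n)%N -> cspan chi basis (wd w).
  elim: n w => [|n IHn] w.
    rewrite leqn0 => /eqP w0; have := sub_sorted_word w.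
    by rewrite w0 /= => /eqP; rewrite subr_eq0 => /eqP ->.
  rewrite leq_eqVlt => /orP[/eqP wn|]; last exact: IHn.
  rewrite -[wd w](subrK (wd (sorted_word w))); apply: cspan_add => //.
  apply: (span_fil n) => //; have := sub_sorted_word w.
  by rewrite wn.
move=> a; have [n Fa] := FA_exhaustive A_gen a.
exact: span_fil (span_word n) a Fa.
Qed.

End FiniteOverCenter.

(** * The theorem *)

Lemma alg_iso_sym (k : comNzRingType) (A B : algType k) :
  alg_iso A B -> alg_iso B A.
Proof.
case=> f [h hK Kh].
have hB : zmod_morphism h.
  move=> a b; apply: (can_inj hK); apply: (etrans (Kh _)).
  by rewrite raddfB; congr (_ - _); apply/esym/Kh.
have hM : monoid_morphism h.
  split=> [|a b]; apply: (can_inj hK); apply: (etrans (Kh _)).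
    by rewrite rmorph1.
  by rewrite rmorphM; congr (_ * _); apply/esym/Kh.
have hZ : scalable h.
  move=> c a; apply: (can_inj hK); apply: (etrans (Kh _)).
  by rewrite linearZ; congr (_ *: _); apply/esym/Kh.
pose m1 := GRing.isZmodMorphism.Build _ _ h hB.
pose m2 := GRing.isMonoidMorphism.Build _ _ h hM.
pose m3 := GRing.isScalable.Build _ _ _ _ h hZ.
pose h' : {lrmorphism B -> A} := HB.pack h m1 m2 m3.
by exists h'; exists f.
Qed.

Theorem proposition2p9 (k : closedFieldType) (p : nat)
    (char_k : p \in [pchar k]) (p_gt2 : (2 < p)%N) :
  [/\ exists F : filtration (double_alg k),
        exhaustive F /\ alg_iso (gr F) (laurent_mpoly k 5),
      noetherian (double_alg k) /\
        GRing.integral_domain_axiom (double_alg k)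
    & PI_algebra (double_alg k)].
Proof.
have two_neq0 : 2%:R != 0 :> k.
  apply/negP => two0; have : (p %| 2)%N by rewrite (dvdn_pcharf char_k).
  by move=> /(dvdn_leq (isT : 0 < 2)%N); rewrite leqNgt p_gt2.
have S := smashA two_neq0; have A_gen := doubleA_generated two_neq0.
have A_lift := @double_lift k two_neq0.
have exhF := FA_exhaustive A_gen.
have [Pi [nu [bijPi _ _]]] := gr_iso two_neq0 S A_lift
  (@laurent_mpoly_comm k 5) (lamTK k 5) (lamTKV k 5) (@laurent_mpoly_ind k 5)
  (@laurent_mpoly_lift k 5).
have domF := gr_domain two_neq0 S A_lift
  (@laurent_mpoly_comm k 5) (lamTK k 5) (lamTKV k 5) (@laurent_mpoly_ind k 5)
  (@laurent_mpoly_lift k 5).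
have [C [chi [bs [noethC chiC span]]]] := finite_over_center char_k p_gt2 S A_gen.
split.
- exists (FA (gA k) (tA k) (XA k) (uA k) (eA k) (vA k) (zA k)); split=> //.
  by apply: alg_iso_sym; exists Pi.
- split; first exact: (@finite_over_center_noetherian _ _ chi chiC bs).
  exact: filtered_domain exhF domF.
- exact: (@finite_over_center_PI _ _ _ chi bs).
Qed.
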